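(* Let $(G,H)$ be a pair of dual groups and $\nu = (\nu_N)_{N\in\mathbb{N}}$ a measure sequence on $H$. (1) Suppose $\nu$ is good and let $\mu$ be a complex Borel measure on $G$. Then $$\lim_{N\to\infty} \|\widehat{\mu}\|_N^2 = \int_{G\times G} \mathrm{c}_\nu(g_0 g_1^{-1})\,(\mu\otimes\overline{\mu})(\mathrm{d}(g_0,g_1)).$$ (2) Suppose $\nu$ is good and let $\mu$ be a probability measure on $G$. If $\lim_{N\to\infty}\|\widehat{\mu}\|_N^2 = 1$, then the support of $\mu$ is contained in a coset of $\overline{\Gamma_\nu}$, and $\mathrm{c}_\nu(g_0 g_1^{-1}) = 1$ for every pair of $\mu$-atoms $g_0, g_1$. (3) Let $\mu$ be a discrete probability measure on $G$. If $\mathrm{c}_\nu(g_0 g_1^{-1}) = 1$ for every pair of $\mu$-atoms $g_0, g_1$, then $\lim_{N\to\infty}\|\widehat{\mu}\|_N^2 = 1$. (4) The measure sequence $\nu$ is ergodic if and only if $$\lim_{N\to\infty}\|\widehat{\mu}\|_N^2 = \sum_{a \text{ atom}} |\mu\{a\}|^2$$ for every complex Borel measure $\mu$ on $G$, where the sum is over all atoms of $\mu$. (5) Let $\nu$ be ergodic and $\mu$ a probability measure on $G$. Then $\lim_{N\to\infty}\|\widehat{\mu}\|_N^2 = 1$ if and only if $\mu$ is a Dirac measure (i.e. $\mu = \delta_g$ for some $g\in G$).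
   Context: A pair of dual groups $(G,H)$ consists of locally compact abelian groups $G$, $H$ (written multiplicatively, with identity $1$) together with an isomorphism $\psi : H \to \widehat{G}$ of $H$ with the Pontryagin dual of $G$; one writes $\langle g,h\rangle := \psi(h)(g) \in \mathbb{T}$, where $\mathbb{T}$ is the unit circle. A measure sequence on $H$ is a sequence $\nu=(\nu_N)_{N\in\mathbb{N}}$ of (Borel) probability measures on $H$; $\|\cdot\|_N$ denotes the $\mathrm{L}^2$-norm with respect to $\nu_N$. Complex measures are finite by definition; $\overline{\mu}$ is the complex conjugate of $\mu$, and the Fourier transform of a complex measure $\mu$ on $G$ is $\widehat{\mu}(h) = \int_G \langle g,h\rangle\,\mu(\mathrm{d}g)$, $h\in H$. An atom of $\mu$ is a point $a\in G$ with $\mu\{a\}\neq 0$. Define $\mathrm{c}_\nu(g) = \lim_{N\to\infty} \int_H \langle g,h\rangle\,\nu_N(\mathrm{d}h)$ for $g \in G$ whenever this limit exists; a condition such as $\mathrm{c}_\nu(g)=1$ includes the existence of the limit. The measure sequence $\nu$ is good if the limit $\mathrm{c}_\nu(g)$ exists for every $g\in G$. It is ergodic if it is good and its spectrum $\{g\in G : \mathrm{c}_\nu(g)\neq 0\}$ equals $\{1\}$. Finally $\Gamma_\nu := \{g\in G : |\mathrm{c}_\nu(g)| = 1\}$, which is a subgroup of $G$; $\overline{\Gamma_\nu}$ is its closure in $G$.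
   Formalization: ''Borel measure'' is read as regular Borel measure: the measures ν_N are assumed inner regular throughout, and μ is assumed inner regular in (1), (2), (4) and (5) (automatic for second countable groups). *)

(* Defs.v *)
From HB Require Import structures.
From mathcomp Require Import all_boot all_order all_algebra.
From mathcomp Require Import all_classical all_reals all_analysis.
From mathcomp Require Export complex.

Set Implicit Arguments.
Unset Strict Implicit.
Unset Printing Implicit Defensive.

Import Order.TTheory GRing.Theory Num.Theory.
Import numFieldNormedType.Exports.

Local Open Scope classical_set_scope.
Local Open Scope ring_scope.
Local Open Scope complex_scope.

(** * Locally compact abelian groups and their duals *)

(* Abelian topological groups are written additively, as in the library:
   [g0 - g1] stands for g_0 g_1^{-1} and [0] for the identity. Locally compact
   groups are Hausdorff by convention. *)
HB.mixin Record isLCA G & TopologicalZmodule G := {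
  lca_hausdorff : hausdorff_space G;
  lca_locally_compact : locally_compact [set: G]
}.

#[short(type="lcaGroupType")]
HB.structure Definition LCAGroup := {G of TopologicalZmodule G & isLCA G}.

Section dual.
Context (R : realType) (G : lcaGroupType).

(* [R[i]^o] is [R[i]] with the topology given by the modulus. *)
Definition is_character (chi : G -> R[i]^o) : Prop :=
  [/\ continuous chi,
      forall x y, chi (x + y) = chi x * chi y :> R[i]
    & forall x, `|chi x : R[i]| = 1].

Definition dual : Type := {chi : G -> R[i]^o | is_character chi}.

HB.instance Definition _ := gen_eqMixin dual.
HB.instance Definition _ := gen_choiceMixin dual.

Definition dual_fun (chi : dual) : {compact-open, G -> R[i]^o} := sval chi.

HB.instance Definition _ := Topological.copy dual (initial_topology dual_fun).

End dual.

(* An isomorphism of topological groups from H onto the Pontryagin dual of G,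
   whose group law is pointwise multiplication. *)
Record dual_pair (R : realType) (G H : lcaGroupType) := DualPair {
  dual_iso :> H -> dual R G;
  dual_isoD : forall h h' g, dual_fun (dual_iso (h + h')) g =
    dual_fun (dual_iso h) g * dual_fun (dual_iso h') g :> R[i];
  dual_iso_bij : set_bij [set: H] [set: dual R G] dual_iso;
  dual_iso_continuous : continuous dual_iso;
  dual_iso_open : forall U : set H, open U -> open (dual_iso @` U)
}.

Definition pairing (R : realType) (G H : lcaGroupType) (psi : dual_pair R G H)
  (g : G) (h : H) : R[i] := dual_fun (psi h) g.

(** * Complex measures and their integrals *)

(* The library's charges are the finite signed measures. *)
Record complex_measure d (T : measurableType d) (R : realType) := ComplexMeasure {
  cm_re : {charge set T -> \bar R};
  cm_im : {charge set T -> \bar R}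
}.

Definition cm_val d (T : measurableType d) (R : realType)
    (mu : complex_measure T R) (A : set T) : R[i] :=
  fine (cm_re mu A) +i* fine (cm_im mu A).

Coercion cm_val : complex_measure >-> Funclass.

Definition cm_conj d (T : measurableType d) (R : realType)
    (mu : complex_measure T R) : complex_measure T R :=
  ComplexMeasure (cm_re mu) (copp (cm_im mu)).

Definition cm_of_prob d (T : measurableType d) (R : realType)
    (mu : probability T R) : complex_measure T R :=
  ComplexMeasure (charge_of_finite_measure mu) czero.

Section jordan_parts.
Context d (T : measurableType d) (R : realType).
Variable nu : {charge set T -> \bar R}.

Let PN := cid (Hahn_decomposition nu).
Definition hahn_pos : set T := sval PN.
Definition hahn_neg : set T := sval (cid (svalP PN)).
Definition hahn_posneg : hahn_decomposition nu hahn_pos hahn_neg :=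
  svalP (cid (svalP PN)).

Definition charge_pos : {finite_measure set T -> \bar R} :=
  jordan_pos hahn_posneg.
Definition charge_neg : {finite_measure set T -> \bar R} :=
  jordan_neg hahn_posneg.

End jordan_parts.

Definition modulus (R : realType) (z : R[i]) : R := complex.Re `|z|.

Section integrals.
Context d (T : measurableType d) (R : realType).
Implicit Types f : T -> R[i].

Definition integral_meas (m : {measure set T -> \bar R}) f : R[i] :=
  (\int[m]_x complex.Re (f x))%R +i* (\int[m]_x complex.Im (f x))%R.

Definition integral_charge (nu : {charge set T -> \bar R}) f : R[i] :=
  integral_meas (charge_pos nu) f - integral_meas (charge_neg nu) f.

Definition integral_cm (mu : complex_measure T R) f : R[i] :=
  integral_charge (cm_re mu) f + 'i * integral_charge (cm_im mu) f.

Definition L2norm (m : {measure set T -> \bar R}) f : R :=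
  fine ('N[m]_2%:E[EFin \o @modulus R \o f]).

End integrals.

Section products.
Context d1 d2 (T1 : measurableType d1) (T2 : measurableType d2) (R : realType).

Section product_finite_measure.
Variables (m1 : {finite_measure set T1 -> \bar R}).
Variables (m2 : {finite_measure set T2 -> \bar R}).

Definition fin_prod : set (T1 * T2)%type -> \bar R := (m1 \x m2)%E.

HB.instance Definition _ := Measure.on fin_prod.

Let fin_prod_fin : fin_num_fun fin_prod.
Proof.
apply: lty_fin_num_fun => /=; rewrite /fin_prod -setXTT product_measure1E//.
by rewrite lte_mul_pinfty ?fin_num_measure// ltey_eq fin_num_measure.
Qed.

HB.instance Definition _ := Measure_isFinite.Build _ _ _ fin_prod fin_prod_fin.

End product_finite_measure.

Definition prod_charge (m : {charge set T1 -> \bar R})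
    (n : {charge set T2 -> \bar R}) : {charge set (T1 * T2)%type -> \bar R} :=
  let pr p q := charge_of_finite_measure (fin_prod p q) in
  cadd (cadd (pr (charge_pos m) (charge_pos n))
             (pr (charge_neg m) (charge_neg n)))
       (copp (cadd (pr (charge_pos m) (charge_neg n))
                   (pr (charge_neg m) (charge_pos n)))).

(* Lives on the product sigma-algebra, which may be smaller than the Borel
   sigma-algebra of the product space. For inner regular factors the product is
   carried by a sigma-compact rectangle, on which continuous functions (hence
   their sequential limits) are measurable for the product sigma-algebra. *)
Definition prod_cm (mu : complex_measure T1 R) (nu : complex_measure T2 R) :
    complex_measure (T1 * T2)%type R :=
  ComplexMeasure
    (cadd (prod_charge (cm_re mu) (cm_re nu))
          (copp (prod_charge (cm_im mu) (cm_im nu))))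
    (cadd (prod_charge (cm_re mu) (cm_im nu))
          (prod_charge (cm_im mu) (cm_re nu))).

End products.

(** * Borel measures on locally compact abelian groups *)

(* Measurable types are pointed in the library; the point plays no role. *)
Definition pointed_lca (G : lcaGroupType) : pointedType :=
  HB.pack (LCAGroup.sort G) (isPointed.Build G 0).

Definition borel (G : lcaGroupType) :=
  @g_sigma_algebraType (pointed_lca G) (@open G).

Section borel_measures.
Context (R : realType) (G : lcaGroupType).

(* Regularity of a finite Borel measure: inner regularity on all Borel sets
   gives outer regularity by taking complements. *)
Definition inner_regular (m : set (borel G) -> \bar R) : Prop :=
  forall A : set (borel G), measurable A -> forall e : R, 0 < e ->
    exists K : set G, [/\ compact K, K `<=` A & (m (A `\` K) < e%:E)%E].

(* Equivalent to inner regularity of the total variation of [mu]. *)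
Definition cm_inner_regular (mu : complex_measure (borel G) R) : Prop :=
  inner_regular (charge_variation (hahn_posneg (cm_re mu))) /\
  inner_regular (charge_variation (hahn_posneg (cm_im mu))).

Definition atoms (mu : complex_measure (borel G) R) : set G :=
  [set a | mu [set a] != 0].

Definition measure_support (mu : probability (borel G) R) : set G :=
  [set x | forall U : set G, open U -> U x -> (0 < mu U)%E].

Definition discrete_measure (mu : probability (borel G) R) : Prop :=
  exists2 A : set G, countable A & mu (~` A) = 0%E.

End borel_measures.

(** * Measure sequences *)

Section measure_sequences.
Context (R : realType) (G H : lcaGroupType) (psi : dual_pair R G H).
Variable nu : nat -> probability (borel H) R.

Definition fourier (mu : complex_measure (borel G) R) (h : H) : R[i] :=
  integral_cm mu (fun g => pairing psi g h).

Definition mean_seq (g : G) (N : nat) : R[i]^o :=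
  integral_meas (nu N) (pairing psi g).

(* [c_at g z] says that the limit c_nu(g) exists and equals z. *)
Definition c_at (g : G) (z : R[i]) : Prop := mean_seq g @ \oo --> (z : R[i]^o).

(* The value is meaningful only when the limit exists. *)
Definition c_fun (g : G) : R[i] := lim (mean_seq g @ \oo).

Definition good : Prop := forall g, cvg (mean_seq g @ \oo).

Definition spectrum : set G := [set g | exists2 z, c_at g z & z != 0].

Definition ergodic : Prop := good /\ spectrum = [set 0].

Definition Gamma : set G := [set g | exists2 z, c_at g z & `|z| = 1].

End measure_sequences.

(* Main.v *)
Require Import Defs.
From HB Require Import structures.
From mathcomp Require Import all_boot all_order all_algebra.
From mathcomp Require Import finmap.
From mathcomp Require Import all_classical all_reals all_analysis.
From mathcomp Require Import complex measurable_realfun ring lra.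

Set Implicit Arguments.
Unset Strict Implicit.
Unset Printing Implicit Defensive.

Import Order.TTheory GRing.Theory Num.Theory.
Import numFieldNormedType.Exports.

Local Open Scope classical_set_scope.
Local Open Scope ring_scope.
Local Open Scope complex_scope.

(** The square norm is a double integral of means of characters. Write
    [m_N g] for [mean_seq psi nu g N], the integral of [<g, h>] against [nu_N].
    For finite measures [p], [q] on [G], Fubini's theorem gives

      int p^(h) conj(q^(h)) nu_N(dh) = int m_N(x - y) (p x q)(d(x, y)),

    because [<x, h> conj(<y, h>) = <x - y, h>]. A complex measure is a
    combination, with coefficients 1, -1, i, -i, of four finite measures, so
    the square norm of its transform is a combination of such integrals
    ([mean_square_cm]). Every claim is read off from this identity as [N] goes
    to infinity, using [|m_N| <= 1] and dominated convergence:

    - if [m_N] converges to [c], the square norms converge to the integral of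
      [c(x - y)], which is the first claim ([mean_square_cvg]);
    - if [mu] is a probability measure and the limit is 1, then, as [|c| <= 1],
      [c(x - y) = 1] for almost all [(x, y)] ([mean_square_cvg1_ae]). A pair of
      atoms has positive mass, hence is not exceptional; and some [a] satisfies
      [c(a - y) = 1] for almost all [y], so almost all [y] lie in the coset of
      [a] ([mean_square_cvg1]). For discrete [mu] the converse is dominated
      convergence on pairs of atoms ([discrete_mean_square]);
    - in the ergodic case [c(x - y)] is the indicator function of the diagonal,
      and [(p x q)(diagonal)] is the sum of [p{a} q{a}] ([fin_prod_diagonal]);
      the combination of these sums is the sum of [|mu{a}|^2]
      ([ergodic_mean_square]). If [c(x - y) = 1] almost everywhere, then
      [mu] is carried by a point ([ergodic_dirac]);
    - the measures [delta_0 + w delta_g] have square norm [2 + 2 Re(w m_N(g))].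
      If the limit is the sum over the atoms, namely 2, then [w = 1] and
      [w = i] give [m_N(g) --> 0] for [g != 0] ([mean_square_ergodic]).

    The technical difficulty is measurability. The pairing is continuous, but
    the Borel sigma-algebra of [G * H] may be larger than the product of the
    Borel sigma-algebras, for which Fubini's theorem holds. Inner regularity
    provides sigma-compact sets [S] and [L] of full measure, and on [S * L] the
    pairing is measurable for the product ([bounded_pairing]): a continuous
    function on a compact rectangle is, up to any error, constant on the cells
    of a finite cover by rectangles. All functions below are therefore only
    known to be measurable on a set of full measure, outside of which
    [integral_full] allows replacing them by 0. *)

(** * Integrals over a set of full measure *)

Section null_sets.
Local Open Scope ereal_scope.
Context d (T : measurableType d) (R : realType).
Variables (m : {measure set T -> \bar R}) (D : set T).
Hypotheses (mD : measurable D) (D0 : m (~` D) = 0).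
Import HBNNSimple.

Let sintegral_restrict (h : {nnsfun T >-> R}) :
  sintegral m (mul_nnsfun h (indic_nnsfun R mD)) = sintegral m h.
Proof.
rewrite -!integralT_nnsfun; apply: ge0_ae_eq_integral => //.
- exact/measurable_EFinP.
- exact/measurable_EFinP.
- by move=> x _; rewrite lee_fin fun_ge0.
- by move=> x _; rewrite lee_fin fun_ge0.
exists (~` D); split => //; first exact: measurableC.
move=> x /= hx Dx; apply: hx => _.
by rewrite /= mindicE mem_set// mulr1.
Qed.

Let ge0_integral_full (f : T -> \bar R) : (forall x, 0 <= f x) ->
  \int[m]_x f x = \int[m]_(x in D) f x.
Proof.
move=> f0; rewrite integral_mkcond [RHS]integral_mkcond.
have g0 x : 0 <= (f \_ D) x by rewrite /patch; case: ifP.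
rewrite patch_setT !ge0_integralTE//; apply/eqP; rewrite eq_le; apply/andP; split.
- apply: ge_ereal_sup => _ [h /= hf <-]; apply: ereal_sup_ubound => /=.
  exists (mul_nnsfun h (indic_nnsfun R mD)); last exact: sintegral_restrict.
  move=> x; rewrite /= /patch mindicE; case: ifPn => xD; first by rewrite mulr1.
  by rewrite mulr0.
- apply: ge_ereal_sup => _ [h /= hf <-]; apply: ereal_sup_ubound => /=.
  exists h => // x; apply: le_trans (hf x) _.
  by rewrite /patch; case: ifP.
Qed.

(** The integral of an arbitrary function [f >= 0] is the supremum of the
    integrals of the simple functions below [f], and cutting these off outside
    of a set of full measure does not change their integrals. This gives a
    meaning to the transforms and the means below, which are shown to be
    measurable on a set of full measure. *)
Lemma integral_full (f : T -> \bar R) : \int[m]_x f x = \int[m]_(x in D) f x.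
Proof.
rewrite [LHS]integralE [RHS]integralE.
by congr (_ - _); apply: ge0_integral_full => x.
Qed.

End null_sets.

(** * Bounded measurable functions and Fubini's theorem *)

(** Such functions are integrable for all finite measures, and they are stable
    under partial integration, so that no integrability hypothesis has to be
    carried along. *)
Definition bounded_mfun d (T : measurableType d) (R : realType) (f : T -> R) :=
  measurable_fun setT f /\ exists M, forall x, `|f x| <= M.

Section bounded_measurable.
Context d (T : measurableType d) (R : realType).
Implicit Types f g : T -> R.

Lemma bounded_mfun_cst (r : R) : bounded_mfun (fun _ : T => r).
Proof. by split; [exact: measurable_cst|exists `|r|]. Qed.

Lemma bounded_mfunD f g : bounded_mfun f -> bounded_mfun g ->
  bounded_mfun (fun x => f x + g x).
Proof.
move=> [mf [M fM]] [mg [N gN]]; split; first exact: measurable_funD.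
by exists (M + N) => x; rewrite (le_trans (ler_normD _ _))// lerD.
Qed.

Lemma bounded_mfunN f : bounded_mfun f -> bounded_mfun (fun x => - f x).
Proof.
move=> [mf [M fM]]; split; first exact: measurableT_comp.
by exists M => x; rewrite normrN.
Qed.

Lemma bounded_mfunB f g : bounded_mfun f -> bounded_mfun g ->
  bounded_mfun (fun x => f x - g x).
Proof. by move=> bf /bounded_mfunN; exact: bounded_mfunD. Qed.

Lemma bounded_mfunM f g : bounded_mfun f -> bounded_mfun g ->
  bounded_mfun (fun x => f x * g x).
Proof.
move=> [mf [M fM]] [mg [N gN]]; split; first exact: measurable_funM.
by exists (M * N) => x; rewrite normrM ler_pM.
Qed.

Lemma bounded_mfun_patch D f : measurable D -> bounded_mfun f ->
  bounded_mfun (patch (fun=> 0) D f).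
Proof.
move=> mD [mf [M fM]]; split.
  exact/(measurable_restrictT f mD)/measurable_funTS.
exists M => x; rewrite /patch; case: ifP => // _.
by rewrite normr0 (le_trans _ (fM x)).
Qed.

Lemma bounded_mfun_comp d' (T' : measurableType d') (u : T' -> T) f :
  measurable_fun setT u -> bounded_mfun f -> bounded_mfun (f \o u).
Proof.
move=> mu [mf [M fM]]; split; first exact: measurableT_comp.
by exists M => x /=.
Qed.

Lemma bounded_mfun_integrable (m : {finite_measure set T -> \bar R}) f :
  bounded_mfun f -> m.-integrable setT (EFin \o f).
Proof.
move=> [mf [M fM]]; apply: (@le_integrable _ _ _ m setT measurableT _ (EFin \o cst M)).
- exact/measurable_EFinP.
- by move=> x _ /=; rewrite lee_fin (le_trans (fM x))// ler_norm.
- exact: finite_measure_integrable_cst.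
Qed.

End bounded_measurable.

Section fubini.
Context d1 d2 (T1 : measurableType d1) (T2 : measurableType d2) (R : realType).
Variables (m1 : {finite_measure set T1 -> \bar R})
  (m2 : {finite_measure set T2 -> \bar R}) (f : T1 * T2 -> R).
Hypothesis bf : bounded_mfun f.

Let prod_integrable (n1 : {finite_measure set T1 -> \bar R})
    (n2 : {finite_measure set T2 -> \bar R}) :
  (n1 \x n2)%E.-integrable setT (EFin \o f).
Proof. exact: (@bounded_mfun_integrable _ _ _ (fin_prod n1 n2)). Qed.

Lemma bounded_mfun_section1 x : bounded_mfun (fun y => f (x, y)).
Proof. by apply: (bounded_mfun_comp (u := pair x)). Qed.

Lemma bounded_mfun_section2 y : bounded_mfun (fun x => f (x, y)).
Proof. by apply: (bounded_mfun_comp (u := pair^~ y)). Qed.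

Let le_bounded_integral d (T : measurableType d) (g : T -> R) M
    (m : {finite_measure set T -> \bar R}) : bounded_mfun g ->
  (forall x, `|g x| <= M) -> `|\int[m]_x g x| <= M * fine (m setT).
Proof.
move=> bg gM; rewrite -(@Rintegral_cst _ _ _ m)//.
have ig := bounded_mfun_integrable m bg.
apply: le_trans (le_normr_Rintegral measurableT ig) _.
apply: le_Rintegral => //; last exact: finite_measure_integrable_cst.
exact: integrable_norm.
Qed.

Lemma bounded_mfun_integral1 : bounded_mfun (fun x => \int[m2]_y f (x, y)).
Proof.
split.
  (* Integrability on the product is only used to obtain measurability, so any
     measure serves as the other factor, here the zero measure. *)
  by apply: (measurableT_comp (f := fine)) => //;
    exact: measurable_fubini_F (prod_integrable mzero m2).
have [_ [M fM]] := bf.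
exists (M * fine (m2 setT)) => x; apply: le_bounded_integral => //.
exact: bounded_mfun_section1.
Qed.

Lemma bounded_mfun_integral2 : bounded_mfun (fun y => \int[m1]_x f (x, y)).
Proof.
split.
  by apply: (measurableT_comp (f := fine)) => //;
    exact: measurable_fubini_G (prod_integrable m1 mzero).
have [_ [M fM]] := bf.
exists (M * fine (m1 setT)) => y; apply: le_bounded_integral => //.
exact: bounded_mfun_section2.
Qed.

Lemma Rintegral_prod1 :
  \int[fin_prod m1 m2]_z f z = \int[m1]_x \int[m2]_y f (x, y).
Proof.
rewrite /Rintegral; congr fine; transitivity (\int[m1 \x m2]_z (f z)%:E)%E => //.
rewrite -(integral12_prod_meas1 (prod_integrable m1 m2)); apply: eq_integral => x _.
rewrite fineK//; apply: integrable_fin_num => //.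
exact/bounded_mfun_integrable/bounded_mfun_section1.
Qed.

Lemma Rintegral_prod2 :
  \int[fin_prod m1 m2]_z f z = \int[m2]_y \int[m1]_x f (x, y).
Proof.
rewrite /Rintegral; congr fine; transitivity (\int[m1 \x m2]_z (f z)%:E)%E => //.
rewrite -(integral21_prod_meas1 (prod_integrable m1 m2)); apply: eq_integral => x _.
rewrite fineK//; apply: integrable_fin_num => //.
exact/bounded_mfun_integrable/bounded_mfun_section2.
Qed.

End fubini.

(** * Complex numbers through their real and imaginary parts *)

Section complex_parts.
Context (R : realType).
Implicit Types x y z : R[i].

Lemma ReD x y : complex.Re (x + y) = complex.Re x + complex.Re y.
Proof. by case: x y => [a b] [c e]. Qed.

Lemma ImD x y : complex.Im (x + y) = complex.Im x + complex.Im y.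
Proof. by case: x y => [a b] [c e]. Qed.

Lemma ReN x : complex.Re (- x) = - complex.Re x.
Proof. by case: x. Qed.

Lemma ImN x : complex.Im (- x) = - complex.Im x.
Proof. by case: x. Qed.

Lemma ReM x y :
  complex.Re (x * y) = complex.Re x * complex.Re y - complex.Im x * complex.Im y.
Proof. by case: x y => [a b] [c e]. Qed.

Lemma ImM x y :
  complex.Im (x * y) = complex.Re x * complex.Im y + complex.Im x * complex.Re y.
Proof. by case: x y => [a b] [c e]. Qed.

Lemma ReJ x : complex.Re x^* = complex.Re x.
Proof. by case: x. Qed.

Lemma ImJ x : complex.Im x^* = - complex.Im x.
Proof. by case: x. Qed.

Lemma eq_ReIm x y :
  complex.Re x = complex.Re y -> complex.Im x = complex.Im y -> x = y.
Proof. by case: x y => [a b] [c e] /= -> ->. Qed.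

Lemma modulus_sqr z : modulus z ^+ 2 = complex.Re z ^+ 2 + complex.Im z ^+ 2.
Proof. by rewrite /modulus normc_def sqr_sqrtr// addr_ge0// sqr_ge0. Qed.

Lemma modulus_ge0 z : 0 <= modulus z.
Proof. by rewrite /modulus normc_def sqrtr_ge0. Qed.

Lemma norm_Re_le z : `|complex.Re z| <= modulus z.
Proof.
rewrite -(@ler_pXn2r _ 2)// ?nnegrE ?modulus_ge0// real_normK ?num_real//.
by rewrite modulus_sqr lerDl sqr_ge0.
Qed.

Lemma norm_Im_le z : `|complex.Im z| <= modulus z.
Proof.
rewrite -(@ler_pXn2r _ 2)// ?nnegrE ?modulus_ge0// real_normK ?num_real//.
by rewrite modulus_sqr lerDr sqr_ge0.
Qed.

Lemma modulusM x y : modulus (x * y) = modulus x * modulus y.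
Proof. by rewrite /modulus normrM !normc_def /=; ring. Qed.

Lemma modulusJ z : modulus z^*%C = modulus z.
Proof. by rewrite /modulus normcJ. Qed.

Lemma mulcJ z : z * z^* = (modulus z ^+ 2)%:C.
Proof. by rewrite -sqr_normc modulus_sqr add_Re2_Im2. Qed.

(** Reduces limits in the complex plane to the convergence theorems for real-
    valued functions. *)
Lemma cvg_complexP (F : set_system nat) (FF : Filter F) (u : nat -> R[i]) l :
  ((u : nat -> R[i]^o) @ F --> (l : R[i]^o)) <->
  ((fun n => complex.Re (u n)) @ F --> complex.Re l /\
   (fun n => complex.Im (u n)) @ F --> complex.Im l).
Proof.
split=> [ul|[ur ui]].
  have h (e : R) : 0 < e -> \forall n \near F, modulus (l - u n) < e.
    move=> e0; move/cvgrPdist_lt : ul => /(_ e%:C); rewrite ltcR => /(_ e0).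
    by apply: filterS => n; rewrite normc_def ltcR /modulus normc_def.
  split; apply/cvgrPdist_lt => e e0; have := h e e0; apply: filterS => n;
    apply: le_lt_trans.
    by rewrite -ReN -ReD norm_Re_le.
  by rewrite -ImN -ImD norm_Im_le.
apply/cvgrPdist_lt => -[e e'] /=; rewrite ltcE /= => /andP[/eqP-> e0].
move/cvgrPdist_lt : ur => /(_ (e / 2)); rewrite divr_gt0// => /(_ isT) ur.
move/cvgrPdist_lt : ui => /(_ (e / 2)); rewrite divr_gt0// => /(_ isT) ui.
near=> n.
have unr : `|complex.Re l - complex.Re (u n)| < e / 2 by near: n; exact: ur.
have uni : `|complex.Im l - complex.Im (u n)| < e / 2 by near: n; exact: ui.
rewrite normc_def ltcR -(@ltr_pXn2r _ 2)// ?nnegrE ?sqrtr_ge0 ?(ltW e0)//.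
rewrite sqr_sqrtr ?addr_ge0 ?sqr_ge0// ReD ReN ImD ImN.
rewrite -(real_normK (num_real (_ - complex.Re _))).
rewrite -(real_normK (num_real (_ - complex.Im _))).
have h (a : R) : 0 <= a -> a < e / 2 -> a ^+ 2 <= e ^+ 2 / 4.
  move=> a0 ae; rewrite (_ : e ^+ 2 / 4 = (e / 2) ^+ 2); last first.
    by rewrite expr_div_n; congr (_ / _); rewrite -natrX.
  by rewrite lerXn2r ?nnegrE// ltW// divr_gt0.
apply: (@le_lt_trans _ _ (e ^+ 2 / 4 + e ^+ 2 / 4)).
  by rewrite lerD// h.
have : 0 < e ^+ 2 by rewrite exprn_gt0.
lra.
Unshelve. all: by end_near. Qed.

End complex_parts.

(** * Integrals of complex-valued functions *)

Definition bounded_cmfun d (T : measurableType d) (R : realType) (f : T -> R[i]) :=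
  bounded_mfun (fun x => complex.Re (f x)) /\
  bounded_mfun (fun x => complex.Im (f x)).

Section bounded_complex.
Context d (T : measurableType d) (R : realType).
Implicit Types f g : T -> R[i].

Lemma bounded_cmfun_cst (z : R[i]) : bounded_cmfun (fun _ : T => z).
Proof. by split; exact: bounded_mfun_cst. Qed.

Lemma bounded_cmfunD f g : bounded_cmfun f -> bounded_cmfun g ->
  bounded_cmfun (fun x => f x + g x).
Proof.
move=> [rf jf] [rg jg]; split.
  by under eq_fun do rewrite ReD; exact: bounded_mfunD.
by under eq_fun do rewrite ImD; exact: bounded_mfunD.
Qed.

Lemma bounded_cmfunM f g : bounded_cmfun f -> bounded_cmfun g ->
  bounded_cmfun (fun x => f x * g x).
Proof.
move=> [rf jf] [rg jg]; split.
  by under eq_fun do rewrite ReM; apply: bounded_mfunB; exact: bounded_mfunM.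
by under eq_fun do rewrite ImM; apply: bounded_mfunD; exact: bounded_mfunM.
Qed.

Lemma bounded_cmfunJ f : bounded_cmfun f -> bounded_cmfun (fun x => (f x)^*).
Proof.
move=> [rf jf]; split; first by under eq_fun do rewrite ReJ.
by under eq_fun do rewrite ImJ; exact: bounded_mfunN.
Qed.

Lemma bounded_cmfun_comp d' (T' : measurableType d') (u : T' -> T) f :
  measurable_fun setT u -> bounded_cmfun f -> bounded_cmfun (f \o u).
Proof.
by move=> mu [rf jf]; split; [exact: bounded_mfun_comp mu rf|
                              exact: bounded_mfun_comp mu jf].
Qed.

Definition cpatch (D : set T) f : T -> R[i] := patch (fun=> 0) D f.

Lemma Re_cpatch D f x :
  complex.Re (cpatch D f x) = patch (fun=> 0) D (fun x => complex.Re (f x)) x.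
Proof. by rewrite /cpatch /patch; case: ifP. Qed.

Lemma Im_cpatch D f x :
  complex.Im (cpatch D f x) = patch (fun=> 0) D (fun x => complex.Im (f x)) x.
Proof. by rewrite /cpatch /patch; case: ifP. Qed.

Lemma cpatch_in D f x : D x -> cpatch D f x = f x.
Proof. by move=> Dx; rewrite /cpatch patchT// inE. Qed.

Lemma cpatch_out D f x : ~ D x -> cpatch D f x = 0.
Proof. by move=> Dx; rewrite /cpatch patchN//; apply/negP; rewrite inE. Qed.

Lemma bounded_cmfun_patch D f : measurable D -> bounded_cmfun f ->
  bounded_cmfun (cpatch D f).
Proof.
move=> mD [rf jf]; split.
  by under eq_fun do rewrite Re_cpatch; exact: bounded_mfun_patch.
by under eq_fun do rewrite Im_cpatch; exact: bounded_mfun_patch.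
Qed.

Lemma bounded_cmfun_patchS D E f : measurable D -> D `<=` E ->
  bounded_cmfun (cpatch E f) -> bounded_cmfun (cpatch D f).
Proof.
move=> mD DE /(bounded_cmfun_patch mD); congr bounded_cmfun.
apply/funext => x; have [Dx|Dx] := pselect (D x).
  by rewrite !cpatch_in//; exact: DE.
by rewrite !cpatch_out.
Qed.

End bounded_complex.

Section complex_integral.
Context d (T : measurableType d) (R : realType).
Implicit Types (f g : T -> R[i]) (m : {finite_measure set T -> \bar R}).

Let integrable_of m (f : T -> R) := @bounded_mfun_integrable _ _ _ m f.

Lemma eq_integral_meas (m : {measure set T -> \bar R}) f g :
  f =1 g -> integral_meas m f = integral_meas m g.
Proof. by move=> /funext ->. Qed.

Lemma integral_meas_measure (m m' : {measure set T -> \bar R}) f :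
  (forall A, measurable A -> m A = m' A) -> integral_meas m f = integral_meas m' f.
Proof.
by move=> mm'; rewrite /integral_meas /Rintegral; congr (fine _ +i* fine _);
  apply: eq_measure_integral => A mA _; exact: mm'.
Qed.

Lemma integral_meas_full (m : {measure set T -> \bar R}) D f :
  measurable D -> m (~` D) = 0%E ->
  integral_meas m f = integral_meas m (cpatch D f).
Proof.
move=> mD D0; apply: eq_ReIm => /=.
  under [RHS]eq_Rintegral do rewrite Re_cpatch.
  by rewrite -Rintegral_mkcond /Rintegral (integral_full mD D0).
under [RHS]eq_Rintegral do rewrite Im_cpatch.
by rewrite -Rintegral_mkcond /Rintegral (integral_full mD D0).
Qed.

Lemma integral_measD m f g : bounded_cmfun f -> bounded_cmfun g ->
  integral_meas m (fun x => f x + g x) = integral_meas m f + integral_meas m g.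
Proof.
move=> [rf jf] [rg jg]; apply: eq_ReIm; rewrite ?ReD ?ImD /=.
  by under eq_Rintegral do rewrite ReD; rewrite RintegralD//; exact: integrable_of.
by under eq_Rintegral do rewrite ImD; rewrite RintegralD//; exact: integrable_of.
Qed.

Lemma integral_measZ m z f : bounded_cmfun f ->
  integral_meas m (fun x => z * f x) = z * integral_meas m f.
Proof.
have scale (k : R) (g : T -> R) : bounded_mfun g -> bounded_mfun (fun x : T => k * g x).
  by apply: bounded_mfunM; exact: bounded_mfun_cst.
move=> [rf jf]; apply: eq_ReIm; rewrite ?ReM ?ImM /=.
  under eq_Rintegral do rewrite ReM.
  rewrite RintegralB//; [|exact/integrable_of/scale|exact/integrable_of/scale].
  by rewrite !RintegralZl//; exact: integrable_of.
under eq_Rintegral do rewrite ImM.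
rewrite RintegralD//; [|exact/integrable_of/scale|exact/integrable_of/scale].
by rewrite !RintegralZl//; exact: integrable_of.
Qed.

Lemma integral_measJ m f : bounded_cmfun f ->
  integral_meas m (fun x => (f x)^*) = (integral_meas m f)^*.
Proof.
move=> [rf jf]; apply: eq_ReIm; rewrite ?ReJ ?ImJ /=.
  by apply: eq_Rintegral => x _; rewrite ReJ.
under eq_Rintegral do rewrite ImJ -mulN1r.
by rewrite RintegralZl ?mulN1r//; exact: integrable_of.
Qed.

Lemma integral_meas_cst m z :
  integral_meas m (fun=> z) = z * (fine (m setT))%:C.
Proof.
rewrite /integral_meas !Rintegral_cst//.
by case: z => a b; apply: eq_ReIm; rewrite ?ReM ?ImM /=; ring.
Qed.

(** With [z] the integral, [|z|^2] is the integral of [Re(conj(z) f)], which is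
    at most [|z|]. *)
Lemma integral_meas_le1 (m : probability T R) f :
  bounded_cmfun f -> (forall x, modulus (f x) <= 1) ->
  modulus (integral_meas m f) <= 1.
Proof.
move=> bf f1; set z := integral_meas m f.
have zf : (modulus z ^+ 2)%:C = integral_meas m (fun x => z^*%C * f x).
  by rewrite integral_measZ// -/z mulrC mulcJ.
clearbody z.
have : modulus z ^+ 2 <= modulus z.
  rewrite -[leLHS]/(complex.Re (modulus z ^+ 2)%:C) zf /=.
  have -> : modulus z = \int[m]_x modulus z.
    by rewrite [RHS]Rintegral_cst// [X in fine X]probability_setT mulr1.
  apply: (@le_Rintegral _ _ _ m) => //.
  - have := bounded_cmfunM (bounded_cmfun_cst T z^*%C) bf.
    by move=> [rf _]; exact: integrable_of rf.
  - exact/integrable_of/bounded_mfun_cst.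
  - move=> x _; apply: le_trans (ler_norm _) _; apply: le_trans (norm_Re_le _) _.
    by rewrite modulusM modulusJ ler_piMr ?modulus_ge0.
have := modulus_ge0 z; nra.
Qed.

End complex_integral.

Section complex_fubini.
Context d1 d2 (T1 : measurableType d1) (T2 : measurableType d2) (R : realType).
Variables (m1 : {finite_measure set T1 -> \bar R})
  (m2 : {finite_measure set T2 -> \bar R}).

Section fubini.
Variable f : T1 * T2 -> R[i].
Hypothesis bf : bounded_cmfun f.

Lemma bounded_cmfun_section1 x : bounded_cmfun (fun y => f (x, y)).
Proof.
by case: bf => rf jf; split;
  [exact: bounded_mfun_section1 rf x|exact: bounded_mfun_section1 jf x].
Qed.

Lemma bounded_cmfun_section2 y : bounded_cmfun (fun x => f (x, y)).
Proof.
by case: bf => rf jf; split;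
  [exact: bounded_mfun_section2 rf y|exact: bounded_mfun_section2 jf y].
Qed.

Lemma bounded_cmfun_integral1 :
  bounded_cmfun (fun x => integral_meas m2 (fun y => f (x, y))).
Proof.
by case: bf => rf jf; split;
  [exact: bounded_mfun_integral1 rf|exact: bounded_mfun_integral1 jf].
Qed.

Lemma bounded_cmfun_integral2 :
  bounded_cmfun (fun y => integral_meas m1 (fun x => f (x, y))).
Proof.
by case: bf => rf jf; split;
  [exact: bounded_mfun_integral2 rf|exact: bounded_mfun_integral2 jf].
Qed.

Lemma integral_meas_prod1 : integral_meas (fin_prod m1 m2) f =
  integral_meas m1 (fun x => integral_meas m2 (fun y => f (x, y))).
Proof.
by case: bf => rf jf; apply: eq_ReIm => /=;
  [exact: (Rintegral_prod1 _ _ rf)|exact: (Rintegral_prod1 _ _ jf)].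
Qed.

Lemma integral_meas_prod2 : integral_meas (fin_prod m1 m2) f =
  integral_meas m2 (fun y => integral_meas m1 (fun x => f (x, y))).
Proof.
by case: bf => rf jf; apply: eq_ReIm => /=;
  [exact: (Rintegral_prod2 _ _ rf)|exact: (Rintegral_prod2 _ _ jf)].
Qed.

End fubini.

(** Fubini for a product; this turns a product of two Fourier transforms into
    one integral over [G * G]. *)
Lemma integral_meas_tensor (f : T1 -> R[i]) (g : T2 -> R[i]) :
  bounded_cmfun f -> bounded_cmfun g ->
  integral_meas (fin_prod m1 m2) (fun z => f z.1 * g z.2) =
  integral_meas m1 f * integral_meas m2 g.
Proof.
move=> bf bg; rewrite integral_meas_prod1; last first.
  by apply: bounded_cmfunM; [exact: (bounded_cmfun_comp (u := fst) (f := f))|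
                             exact: (bounded_cmfun_comp (u := snd) (f := g))].
rewrite mulrC -integral_measZ//; apply: eq_integral_meas => x /=.
by rewrite integral_measZ// mulrC.
Qed.

End complex_fubini.

Section dominated_convergence.
Context d (T : measurableType d) (R : realType).
Variable m : {finite_measure set T -> \bar R}.
Variables (D : set T) (mD : measurable D) (D0 : m (~` D) = 0%E).

Let real_dominated (f_ : nat -> T -> R) f M :
  (forall n, bounded_mfun (patch (fun=> 0) D (f_ n))) ->
  (forall n x, D x -> `|f_ n x| <= M) ->
  (forall x, D x -> f_ ^~ x @ \oo --> f x) ->
  bounded_mfun (patch (fun=> 0) D f) /\
  (fun n => \int[m]_x patch (fun=> 0) D (f_ n) x) @ \oo -->
    \int[m]_x patch (fun=> 0) D f x.
Proof.
move=> bf_ f_M f_f.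
have pf x : (fun n => patch (fun=> 0) D (f_ n) x) @ \oo -->
    patch (fun=> 0) D f x.
  have [Dx|Dx] := pselect (D x).
    rewrite patchT ?inE//; under eq_fun do rewrite patchT ?inE//.
    exact: f_f.
  have xD : x \notin D by apply/negP; rewrite inE.
  by rewrite patchN//; under eq_fun do rewrite patchN//; exact: cvg_cst.
have pM n x : `|patch (fun=> 0) D (f_ n) x| <= `|M|.
  rewrite /patch; case: ifP => [|_]; last by rewrite normr0.
  by rewrite inE => /(f_M n) /le_trans; apply; rewrite ler_norm.
have mf : measurable_fun setT (patch (fun=> 0) D f).
  apply: (@measurable_fun_cvg _ _ _ _ (fun n => patch (fun=> 0) D (f_ n))) => //.
  by move=> n; have [] := bf_ n.
have bf : bounded_mfun (patch (fun=> 0) D f).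
  split => //; exists `|M| => x.
  by apply: (cvgr_to_le (cvg_norm (pf x))); apply: nearW => n; exact: pM.
split => //.
have [| | | | |_ _] := @dominated_convergence _ _ _ m setT measurableT
  (fun n => EFin \o patch (fun=> 0) D (f_ n)) (EFin \o patch (fun=> 0) D f)
  (EFin \o cst `|M|).
- by move=> n; apply/measurable_EFinP; have [] := bf_ n.
- exact/measurable_EFinP.
- by apply: aeW => x _; apply/fine_cvgP; split; [exact: nearW|exact: pf].
- exact: finite_measure_integrable_cst.
- by apply: aeW => x n _; rewrite /= lee_fin; exact: pM.
have fin := integrable_fin_num measurableT (bounded_mfun_integrable m bf).
by rewrite -(fineK fin) => /fine_cvgP[_].
Qed.

(** The bound is 1 because the functions in question are means of characters;
    they are measurable, and converge, on a set [D] of full measure. *)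
Lemma integral_meas_dominated (f_ : nat -> T -> R[i]) f :
  (forall n, bounded_cmfun (cpatch D (f_ n))) ->
  (forall n x, D x -> modulus (f_ n x) <= 1) ->
  (forall x, D x -> (f_ ^~ x : nat -> R[i]^o) @ \oo --> (f x : R[i]^o)) ->
  bounded_cmfun (cpatch D f) /\
  (fun n => integral_meas m (f_ n) : R[i]^o) @ \oo --> (integral_meas m f : R[i]^o).
Proof.
move=> bf_ f_1 f_f.
have [||| br cr] := @real_dominated (fun n x => complex.Re (f_ n x))
    (fun x => complex.Re (f x)) 1.
- by move=> n; have [+ _] := bf_ n; under eq_fun do rewrite Re_cpatch.
- by move=> n x /(f_1 n); apply: le_trans (norm_Re_le _).
- by move=> x /f_f /cvg_complexP[].
have [||| bi ci] := @real_dominated (fun n x => complex.Im (f_ n x))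
    (fun x => complex.Im (f x)) 1.
- by move=> n; have [_ +] := bf_ n; under eq_fun do rewrite Im_cpatch.
- by move=> n x /(f_1 n); apply: le_trans (norm_Im_le _).
- by move=> x /f_f /cvg_complexP[].
split; first by split; [under eq_fun do rewrite Re_cpatch|
                        under eq_fun do rewrite Im_cpatch].
under eq_fun do rewrite (integral_meas_full _ mD D0).
rewrite (integral_meas_full _ mD D0); apply/cvg_complexP; split => /=.
  under eq_fun do under eq_Rintegral do rewrite Re_cpatch.
  by under eq_Rintegral do rewrite Re_cpatch.
under eq_fun do under eq_Rintegral do rewrite Im_cpatch.
by under eq_Rintegral do rewrite Im_cpatch.
Qed.

End dominated_convergence.

(** * Integrals against charges *)

Section sum_of_measures.
Context d (T : measurableType d) (R : realType).
Variables m1 m2 : {finite_measure set T -> \bar R}.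

(** The sum of two finite measures, with its finiteness recorded; it serves to
    compare two decompositions of a charge into positive parts. *)
Definition fin_add : set T -> \bar R := measure_add m1 m2.

HB.instance Definition _ := Measure.on fin_add.

Lemma fin_addE A : fin_add A = (m1 A + m2 A)%E.
Proof. by rewrite /fin_add measure_addE. Qed.

Let fin_add_fin : fin_num_fun fin_add.
Proof. by move=> A mA; rewrite fin_addE fin_numD !fin_num_measure. Qed.

HB.instance Definition _ := Measure_isFinite.Build _ _ _ fin_add fin_add_fin.

Lemma integral_fin_add (f : T -> R[i]) : bounded_cmfun f ->
  integral_meas fin_add f = integral_meas m1 f + integral_meas m2 f.
Proof.
have real_add (g : T -> R) : bounded_mfun g ->
    \int[fin_add]_x g x = \int[m1]_x g x + \int[m2]_x g x.
  move=> bg; have i1 := bounded_mfun_integrable m1 bg.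
  have i2 := bounded_mfun_integrable m2 bg.
  rewrite /Rintegral -fineD ?integrable_fin_num//; congr fine.
  by rewrite -(@integral_measure_add _ _ _ m1 m2).
by move=> [rf jf]; apply: eq_ReIm; rewrite ?ReD ?ImD /= real_add.
Qed.

End sum_of_measures.

Section charges.
Context d (T : measurableType d) (R : realType).
Implicit Types (nu : {charge set T -> \bar R}) (f : T -> R[i])
  (p q : {finite_measure set T -> \bar R}).

Lemma charge_posE nu A : measurable A -> charge_pos nu A = nu (A `&` hahn_pos nu).
Proof. by move=> mA; rewrite [LHS]jordan_posE cjordan_posE /crestr0 mem_set. Qed.

Lemma charge_negE nu A : measurable A ->
  charge_neg nu A = (- nu (A `&` hahn_neg nu))%E.
Proof.
by move=> mA; rewrite [LHS]jordan_negE cjordan_negE /crestr0 mem_set.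
Qed.

Lemma charge_posneg nu A : measurable A ->
  nu A = (charge_pos nu A - charge_neg nu A)%E.
Proof.
move=> mA; rewrite (jordan_decomp (hahn_posneg nu) mA) /cadd /=.
by rewrite cscaleN1.
Qed.

(** A negative set of [nu] is a positive set of [- nu]. The Hahn sets of [- nu]
    are chosen independently of those of [nu]; this and the uniqueness of the
    Hahn decomposition relate the two choices. *)
Lemma hahn_decomposition_copp nu X Y :
  hahn_decomposition (copp nu) X Y -> hahn_decomposition nu Y X.
Proof.
move=> [[mX X0] [mY Y0] XY XY0].
split; [| |by rewrite setUC|by rewrite setIC]; split => // B mB BX.
  by rewrite -leeN2 oppe0; exact: Y0.
by rewrite -leeN2 oppe0; exact: X0.
Qed.

Lemma charge_pos_copp nu A : measurable A -> charge_pos (copp nu) A = charge_neg nu A.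
Proof.
move=> mA; rewrite charge_posE// charge_negE//; congr oppe.
have swap := hahn_decomposition_copp (hahn_posneg (copp nu)).
by have [_] := Hahn_decomposition_uniq swap (hahn_posneg nu) mA.
Qed.

Lemma charge_neg_copp nu A : measurable A -> charge_neg (copp nu) A = charge_pos nu A.
Proof.
move=> mA; rewrite charge_posE// charge_negE//.
have swap := hahn_decomposition_copp (hahn_posneg (copp nu)).
have [<- _] := Hahn_decomposition_uniq swap (hahn_posneg nu) mA.
by rewrite /copp oppeK.
Qed.

(** The total variation of [nu] vanishes on [E]. *)
Definition charge_null nu E := charge_pos nu E = 0%E /\ charge_neg nu E = 0%E.

(** The Jordan parts of [p - q] are dominated by [p] and [q]. *)
Lemma charge_null_diff nu p q E : measurable E ->
  (forall A, measurable A -> nu A = p A - q A)%E ->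
  p E = 0%E -> q E = 0%E -> charge_null nu E.
Proof.
move=> mE nupq p0 q0.
have [[mP _] [mN _] _ _] := hahn_posneg nu.
have null A : measurable A -> nu (E `&` A) = 0%E.
  move=> mA; have mEA : measurable (E `&` A) by exact: measurableI.
  rewrite nupq// (subset_measure0 mEA mE _ p0)//.
  by rewrite (subset_measure0 mEA mE _ q0)// sube0.
by split; rewrite ?charge_posE ?charge_negE ?null ?oppe0.
Qed.

(** If [nu = p - q], then [nu^+ + q = nu^- + p], an identity of finite measures
    along which integrals are additive. So any decomposition of [nu] computes
    its integral, not just the one of Jordan. *)
Lemma integral_charge_diff nu p q f :
  (forall A, measurable A -> nu A = p A - q A)%E -> bounded_cmfun f ->
  integral_charge nu f = integral_meas p f - integral_meas q f.
Proof.
move=> nupq bf; apply/eqP; rewrite /integral_charge subr_eq addrAC eq_sym subr_eq.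
apply/eqP; rewrite -integral_fin_add// -integral_fin_add//.
apply: integral_meas_measure => A mA; rewrite [LHS]fin_addE [RHS]fin_addE.
have := nupq A mA; rewrite charge_posneg//.
have : p A \is a fin_num by exact: fin_num_measure.
have : q A \is a fin_num by exact: fin_num_measure.
have : charge_pos nu A \is a fin_num by exact: fin_num_measure.
have : charge_neg nu A \is a fin_num by exact: fin_num_measure.
move: (charge_neg nu A) (charge_pos nu A) (q A) (p A).
move=> [a| |] [b| |] [c| |] [e| |]// _ _ _ _ [abce]; congr (_%:E); lra.
Qed.

Section carried.
Variables (D : set T) (mD : measurable D).

Let mC : measurable (~` D). Proof. exact: measurableC. Qed.

(** Version of [integral_charge_diff] for an integrand that is measurable on a
    set [D] of full measure; the linearity of the integral in the charge
    follows from it. *)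
Lemma integral_charge_full nu p q f : charge_null nu (~` D) ->
  p (~` D) = 0%E -> q (~` D) = 0%E ->
  (forall A, measurable A -> nu A = p A - q A)%E -> bounded_cmfun (cpatch D f) ->
  integral_charge nu f = integral_meas p f - integral_meas q f.
Proof.
move=> [p0 n0] p1 q1 nupq bf.
rewrite (integral_meas_full _ mD p1) (integral_meas_full _ mD q1).
rewrite -(integral_charge_diff nupq)// /integral_charge.
by rewrite -(integral_meas_full _ mD p0) -(integral_meas_full _ mD n0).
Qed.

Lemma integral_charge_measure p f : p (~` D) = 0%E -> bounded_cmfun (cpatch D f) ->
  charge_null (charge_of_finite_measure p) (~` D) /\
  integral_charge (charge_of_finite_measure p) f = integral_meas p f.
Proof.
move=> p0 bf; pose z : {finite_measure set T -> \bar R} := mzero.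
have pz A : measurable A -> (charge_of_finite_measure p A = p A - z A)%E.
  by move=> _; rewrite /z /mzero sube0.
have n0 := charge_null_diff mC pz p0 erefl; split => //.
rewrite (integral_charge_full n0 p0 _ pz bf)// [X in _ - X](_ : _ = 0) ?subr0//.
by apply: eq_ReIm; rewrite /= /Rintegral integral_measure_zero.
Qed.

Lemma integral_chargeN nu f :
  charge_null nu (~` D) -> bounded_cmfun (cpatch D f) ->
  charge_null (copp nu) (~` D) /\
  integral_charge (copp nu) f = - integral_charge nu f.
Proof.
move=> [p0 n0] bf.
have c0 : charge_null (copp nu) (~` D).
  by split; rewrite ?charge_pos_copp ?charge_neg_copp.
split => //; rewrite [RHS]opprB; apply: integral_charge_full => // A mA.
by rewrite (charge_posneg _ mA) charge_pos_copp// charge_neg_copp.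
Qed.

Lemma integral_chargeD nu nu' f :
  charge_null nu (~` D) -> charge_null nu' (~` D) -> bounded_cmfun (cpatch D f) ->
  charge_null (cadd nu nu') (~` D) /\
  integral_charge (cadd nu nu') f = integral_charge nu f + integral_charge nu' f.
Proof.
move=> [p0 n0] [p0' n0'] bf.
have nn A : measurable A -> (cadd nu nu' A =
   fin_add (charge_pos nu) (charge_pos nu') A -
   fin_add (charge_neg nu) (charge_neg nu') A)%E.
  move=> mA; rewrite [X in (X - _)%E]fin_addE [X in (_ - X)%E]fin_addE /cadd !(charge_posneg _ mA) fin_num_oppeD.
    by rewrite addeACA.
  by rewrite fin_num_measure.
have q0 : fin_add (charge_pos nu) (charge_pos nu') (~` D) = 0%E.
  by rewrite [LHS]fin_addE p0 p0' adde0.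
have q0' : fin_add (charge_neg nu) (charge_neg nu') (~` D) = 0%E.
  by rewrite [LHS]fin_addE n0 n0' adde0.
have c0 := charge_null_diff mC nn q0 q0'; split => //.
rewrite (integral_charge_full c0 q0 q0' nn bf) /integral_charge.
rewrite (integral_meas_full _ mD q0) (integral_meas_full _ mD q0').
rewrite !integral_fin_add// -!(integral_meas_full _ mD)//; ring.
Qed.

End carried.

End charges.

(** * Complex measures as combinations of finite measures *)

Section parts_of_complex_measure.
Context d (T : measurableType d) (R : realType).
Implicit Types (mu : complex_measure T R) (f : T -> R[i]).

(** Together with [cm_coef]: [mu] is the sum of [cm_coef k * cm_part mu k], the
    index being a pair of flags for the real part and for the positive part.
    Sums over the four parts replace the nested Jordan decompositions. *)
Definition cm_part mu (k : bool * bool) : {finite_measure set T -> \bar R} :=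
  let nu := if k.1 then cm_re mu else cm_im mu in
  if k.2 then charge_pos nu else charge_neg nu.

Definition cm_coef (k : bool * bool) : R[i] :=
  (if k.1 then 1 else 'i%C) * (if k.2 then 1 else -1).

Lemma sum_parts (V : zmodType) (F : bool * bool -> V) :
  \sum_k F k = F (true, true) + F (true, false) + (F (false, true) + F (false, false)).
Proof.
transitivity (\sum_(i : bool) \sum_(j : bool) F (i, j)).
  by rewrite pair_bigA; apply: eq_bigr => -[].
by rewrite !big_bool.
Qed.

Lemma integral_cmE mu f :
  integral_cm mu f = \sum_k cm_coef k * integral_meas (cm_part mu k) f.
Proof.
rewrite sum_parts /cm_coef /cm_part /= /integral_cm /integral_charge -complexiE; ring.
Qed.

Lemma cm_valE mu A : measurable A ->
  cm_val mu A = \sum_k cm_coef k * (fine (cm_part mu k A))%:C.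
Proof.
move=> mA; rewrite sum_parts /cm_coef /cm_part /= /cm_val.
rewrite (charge_posneg (cm_re mu) mA) (charge_posneg (cm_im mu) mA).
rewrite !fineB ?fin_num_measure//.
by apply: eq_ReIm; rewrite !(ReD, ImD, ReM, ImM, ReN, ImN) /=; ring.
Qed.

End parts_of_complex_measure.
Arguments cm_coef {R} k.

Section product_of_complex_measures.
Context d1 d2 (T1 : measurableType d1) (T2 : measurableType d2) (R : realType).

Lemma integral_fin_prod_measure (p p' : {finite_measure set T1 -> \bar R})
    (q q' : {finite_measure set T2 -> \bar R}) (f : T1 * T2 -> R[i]) :
  (forall A, measurable A -> p A = p' A) -> (forall A, measurable A -> q A = q' A) ->
  integral_meas (fin_prod p q) f = integral_meas (fin_prod p' q') f.
Proof.
move=> pp' qq'; apply: integral_meas_measure => A mA.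
transitivity (fin_prod p q' A).
  by apply: eq_integral => x _; exact/qq'/measurable_xsection.
by apply: eq_measure_integral => B mB _; exact: pp'.
Qed.

Variables (D : set (T1 * T2)) (mD : measurable D) (f : T1 * T2 -> R[i]).
Hypothesis bf : bounded_cmfun (cpatch D f).

Lemma integral_prod_charge (m : {charge set T1 -> \bar R})
    (n : {charge set T2 -> \bar R}) :
  let I p q := integral_meas (fin_prod p q) f in
  let Z p q := fin_prod p q (~` D) = 0%E in
  Z (charge_pos m) (charge_pos n) -> Z (charge_neg m) (charge_neg n) ->
  Z (charge_pos m) (charge_neg n) -> Z (charge_neg m) (charge_pos n) ->
  charge_null (prod_charge m n) (~` D) /\
  integral_charge (prod_charge m n) f =
    I (charge_pos m) (charge_pos n) + I (charge_neg m) (charge_neg n)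
    - (I (charge_pos m) (charge_neg n) + I (charge_neg m) (charge_pos n)).
Proof.
move=> I Z pp nn pn np; rewrite /prod_charge.
have [cpp ipp] := integral_charge_measure mD pp bf.
have [cnn inn] := integral_charge_measure mD nn bf.
have [cpn ipn] := integral_charge_measure mD pn bf.
have [cnp inp] := integral_charge_measure mD np bf.
have [c1 i1] := integral_chargeD mD cpp cnn bf.
have [c2 i2] := integral_chargeD mD cpn cnp bf.
have [c3 i3] := integral_chargeN mD c2 bf.
have [c4 i4] := integral_chargeD mD c1 c3 bf.
by split => //; rewrite i4 i3 i2 i1 ipp inn ipn inp.
Qed.

End product_of_complex_measures.

(** The right-hand side is what the definition of the product of a complex
    measure with its conjugate produces: the real part carries [re x re - im x
    (- im)], the imaginary part [re x (- im) + im x re], and the Jordan parts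
    of [- im] are those of [im] exchanged. *)
Lemma sesquilinear_expansion (R : realType)
    (I : bool * bool -> bool * bool -> R[i]) :
  let P := true in let N := false in
  \sum_k \sum_l cm_coef k * (cm_coef l)^*%C * I k l =
  (I (P, P) (P, P) + I (P, N) (P, N) - (I (P, P) (P, N) + I (P, N) (P, P)) -
   (I (N, P) (N, N) + I (N, N) (N, P) - (I (N, P) (N, P) + I (N, N) (N, N)))) +
  'i%C *
  ((I (P, P) (N, N) + I (P, N) (N, P) - (I (P, P) (N, P) + I (P, N) (N, N))) +
   (I (N, P) (P, P) + I (N, N) (P, N) - (I (N, P) (P, N) + I (N, N) (P, P)))).
Proof.
move=> P N; rewrite /P /N {P N}.
have coefE : forall k, cm_coef k =
    match k with (true, true) => 1 | (true, false) => -1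
               | (false, true) => 'i%C | (false, false) => - 'i%C end :> R[i].
  by move=> [[] []]; rewrite /cm_coef /= ?mulr1 ?mul1r ?mulrN1.
have coefJ : forall k, (cm_coef k)^*%C =
    match k with (true, true) => 1 | (true, false) => -1
               | (false, true) => - 'i%C | (false, false) => 'i%C end :> R[i].
  by move=> [[] []]; rewrite coefE; apply: eq_ReIm; rewrite /= ?opprK ?oppr0.
have i2 : ('i%C : R[i]) * 'i%C = -1 by rewrite -expr2 sqr_i.
rewrite !sum_parts !coefJ !coefE.
move: i2; move: 'i%C => i i2.
ring: i2.
Qed.

Section square_of_complex_measure.
Context d (T : measurableType d) (R : realType).
Variables (mu : complex_measure T R) (D : set (T * T)) (f : T * T -> R[i]).
Hypotheses (mD : measurable D) (bf : bounded_cmfun (cpatch D f)).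
Hypothesis D0 : forall k l,
  fin_prod (cm_part mu k) (cm_part mu l) (~` D) = 0%E.

(** Puts the double integral of the first claim into the sesquilinear form in
    which the square norms are computed. *)
Lemma integral_prod_cm_conj :
  integral_cm (prod_cm mu (cm_conj mu)) f =
  \sum_k \sum_l cm_coef k * (cm_coef l)^*%C *
    integral_meas (fin_prod (cm_part mu k) (cm_part mu l)) f.
Proof.
have mDC : measurable (~` D) by exact: measurableC.
set a := cm_re mu; set b := cm_im mu.
have null_eq (p q q' : {finite_measure set T -> \bar R}) :
    (forall B, measurable B -> q B = q' B) ->
    fin_prod p q' (~` D) = 0%E -> fin_prod p q (~` D) = 0%E.
  by move=> qq' <-; apply: eq_integral => x _; exact/qq'/measurable_xsection.
have pos_opp := @charge_pos_copp _ T R b.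
have neg_opp := @charge_neg_copp _ T R b.
have [caa iaa] := integral_prod_charge mD bf (D0 (true, true) (true, true))
  (D0 (true, false) (true, false)) (D0 (true, true) (true, false))
  (D0 (true, false) (true, true)).
have [cba iba] := integral_prod_charge mD bf (D0 (false, true) (true, true))
  (D0 (false, false) (true, false)) (D0 (false, true) (true, false))
  (D0 (false, false) (true, true)).
have [|||| cab iab] := integral_prod_charge (m := a) (n := copp b) mD bf.
  - exact: null_eq pos_opp (D0 (true, true) (false, false)).
  - exact: null_eq neg_opp (D0 (true, false) (false, true)).
  - exact: null_eq neg_opp (D0 (true, true) (false, true)).
  - exact: null_eq pos_opp (D0 (true, false) (false, false)).
have [|||| cbb ibb] := integral_prod_charge (m := b) (n := copp b) mD bf.
  - exact: null_eq pos_opp (D0 (false, true) (false, false)).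
  - exact: null_eq neg_opp (D0 (false, false) (false, true)).
  - exact: null_eq neg_opp (D0 (false, true) (false, true)).
  - exact: null_eq pos_opp (D0 (false, false) (false, false)).
rewrite !(integral_fin_prod_measure _ (fun _ _ => erefl) pos_opp) in iab ibb.
rewrite !(integral_fin_prod_measure _ (fun _ _ => erefl) neg_opp) in iab ibb.
have [cNbb iNbb] := integral_chargeN mD cbb bf.
have [_ ire] := integral_chargeD mD caa cNbb bf.
have [_ iim] := integral_chargeD mD cab cba bf.
rewrite (sesquilinear_expansion (fun k l =>
  integral_meas (fin_prod (cm_part mu k) (cm_part mu l)) f)).
transitivity (integral_charge (cadd (prod_charge a a)
    (copp (prod_charge b (copp b)))) f +
  'i%C * integral_charge (cadd (prod_charge a (copp b)) (prod_charge b a)) f).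
  by [].
by rewrite (etrans ire (f_equal2 +%R iaa (etrans iNbb (f_equal -%R ibb))))
  (etrans iim (f_equal2 +%R iab iba)).
Qed.

End square_of_complex_measure.

(** * Square norms of integral transforms *)

Section sums_and_norms.
Context d (T : measurableType d) (R : realType).
Variables (m : {finite_measure set T -> \bar R}) (D : set T).
Hypotheses (mD : measurable D) (D0 : m (~` D) = 0%E).

Lemma integral_meas_sum (I : Type) (r : seq I) (f : I -> T -> R[i]) :
  (forall i, bounded_cmfun (f i)) ->
  bounded_cmfun (fun x => \sum_(i <- r) f i x) /\
  integral_meas m (fun x => \sum_(i <- r) f i x) =
  \sum_(i <- r) integral_meas m (f i).
Proof.
move=> bf; elim: r => [|i r [br ir]].
  under eq_fun do rewrite big_nil; rewrite big_nil.
  by rewrite integral_meas_cst mul0r; split=> //; exact: bounded_cmfun_cst.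
under eq_fun do rewrite big_cons; rewrite big_cons.
by rewrite integral_measD// ir; split=> //; exact: bounded_cmfunD.
Qed.

(** Writes the square norm as the integral of [f conj(f)], which is
    sesquilinear in [f]. *)
Lemma L2norm_sqr (f : T -> R[i]) : bounded_cmfun (cpatch D f) ->
  (L2norm m f ^+ 2)%:C = integral_meas m (fun x => f x * (f x)^*%C).
Proof.
move=> bf; have bff : bounded_cmfun (fun x => cpatch D f x * (cpatch D f x)^*%C).
  exact/bounded_cmfunM/bounded_cmfunJ.
have patch_sqr : cpatch D (fun x => f x * (f x)^*%C) =
    (fun x => cpatch D f x * (cpatch D f x)^*%C).
  apply/funext => x; have [Dx|Dx] := pselect (D x).
    by rewrite !cpatch_in.
  by rewrite !cpatch_out// mul0r.
apply: eq_ReIm => /=; last first.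
  by under eq_Rintegral do rewrite mulcJ /=; rewrite Rintegral_cst// mul0r.
under eq_Rintegral do rewrite mulcJ /=.
rewrite /L2norm unlock.
rewrite [X in (X `^ _)%E](eq_integral (fun x => (modulus (f x) ^+ 2)%:E)); last first.
  by move=> x _; rewrite /= powR_mulrn// ger0_norm ?modulus_ge0.
rewrite /=.
have fin : (\int[m]_x (modulus (f x) ^+ 2)%:E)%E \is a fin_num.
  rewrite (integral_full mD D0) integral_mkcond.
  rewrite (eq_integral (fun x => (modulus (cpatch D f x) ^+ 2)%:E)); last first.
    move=> x _; rewrite /patch; case: ifPn => [|]; rewrite ?inE => Dx.
      by rewrite cpatch_in.
    move/negP : Dx; rewrite inE => Dx; rewrite cpatch_out//.
    by rewrite /modulus normr0 expr0n.
  apply: (@integrable_fin_num _ _ _ m setT measurableT).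
  have [+ _] := bff; under eq_fun do rewrite mulcJ /=.
  exact: bounded_mfun_integrable.
have : (0 <= \int[m]_x (modulus (f x) ^+ 2)%:E)%E.
  by apply: integral_ge0 => x _; rewrite lee_fin sqr_ge0.
rewrite /Rintegral; move: fin; move: (integral _ _ _) => [r| |]//= _.
rewrite lee_fin => r0.
by rewrite -powR_mulrn ?powR_ge0// -powRrM mulVf// powRr1.
Qed.

End sums_and_norms.

Lemma fin_prod_full d1 d2 (T1 : measurableType d1) (T2 : measurableType d2)
    (R : realType) (p : {finite_measure set T1 -> \bar R})
    (q : {finite_measure set T2 -> \bar R}) (A : set T1) (B : set T2) :
  measurable A -> measurable B -> p (~` A) = 0%E -> q (~` B) = 0%E ->
  fin_prod p q (~` (A `*` B)) = 0%E.
Proof.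
move=> mA mB p0 q0.
have mAC : measurable (~` A) by exact: measurableC.
have mBC : measurable (~` B) by exact: measurableC.
apply: (@subset_measure0 _ _ _ (fin_prod p q) _
    ((~` A) `*` setT `|` setT `*` (~` B))).
- by apply: measurableC; exact: measurableX.
- by apply: measurableU; exact: measurableX.
- by move=> [x y] /= /not_andP[Ax|By]; [left|right]; split.
apply: (@null_set_setU _ _ _ (fin_prod p q)); try exact: measurableX.
  by rewrite [LHS]product_measure1E// [X in (X * _)%E]p0 mul0e.
by rewrite [LHS]product_measure1E// [X in (_ * X)%E]q0 mule0.
Qed.

Section gram.
Context d1 d2 (T : measurableType d1) (U : measurableType d2) (R : realType).
Variables (e : T -> U -> R[i]) (S : set T) (L : set U).
Hypotheses (mS : measurable S) (mL : measurable L).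
Hypothesis be : bounded_cmfun (cpatch (S `*` L) (fun z => e z.1 z.2)).
Variable nu : {finite_measure set U -> \bar R}.
Hypothesis L0 : nu (~` L) = 0%E.
Implicit Types p q : {finite_measure set T -> \bar R}.

(** The Gram kernel of the family [e x] in the L2-space of [nu]. For the
    characters [e x = <x, .>] it depends on [x - y] only, see [mean_seq]. *)
Definition gram (x y : T) : R[i] := integral_meas nu (fun u => e x u * (e y u)^*%C).

Let E (z : T * U) := cpatch (S `*` L) (fun z => e z.1 z.2) z.

Let E_in x u : S x -> L u -> E (x, u) = e x u.
Proof. by move=> Sx Lu; rewrite /E cpatch_in. Qed.

Let E_outL x u : ~ L u -> E (x, u) = 0.
Proof. by move=> Lu; rewrite /E cpatch_out//= => -[]. Qed.

Let E_outS x u : ~ S x -> E (x, u) = 0.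
Proof. by move=> Lu; rewrite /E cpatch_out//= => -[]. Qed.

Let transform_patch p u : p (~` S) = 0%E ->
  cpatch L (fun u => integral_meas p (e^~ u)) u = integral_meas p (fun x => E (x, u)).
Proof.
move=> p0; have [Lu|Lu] := pselect (L u); last first.
  rewrite cpatch_out//; under eq_integral_meas do rewrite E_outL//.
  by rewrite integral_meas_cst mul0r.
rewrite cpatch_in// (integral_meas_full _ mS p0).
apply: eq_integral_meas => x; have [Sx|Sx] := pselect (S x).
  by rewrite cpatch_in// E_in.
by rewrite cpatch_out// E_outS.
Qed.

Lemma bounded_transform p : p (~` S) = 0%E ->
  bounded_cmfun (cpatch L (fun u => integral_meas p (e^~ u))).
Proof.
move=> p0; have := bounded_cmfun_integral2 p be; congr bounded_cmfun.
by apply/funext => u; rewrite transform_patch.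
Qed.

Let E2 (z : (T * T) * U) := E (z.1.1, z.2) * (E (z.1.2, z.2))^*%C.

Let bE2 : bounded_cmfun E2.
Proof.
apply: bounded_cmfunM; last apply: bounded_cmfunJ.
  apply: (bounded_cmfun_comp (f := E) (u := fun z : (T * T) * U => (z.1.1, z.2))) => //.
  by apply: measurable_fun_pair => //; exact: measurableT_comp.
apply: (bounded_cmfun_comp (f := E) (u := fun z : (T * T) * U => (z.1.2, z.2))) => //.
by apply: measurable_fun_pair => //; exact: measurableT_comp.
Qed.

Let gram_patch z : cpatch (S `*` S) (fun z => gram z.1 z.2) z =
  integral_meas nu (fun u => E2 (z, u)).
Proof.
have [[Sx Sy]|SS] := pselect ((S `*` S) z); last first.
  rewrite cpatch_out//; under eq_integral_meas => u.
    have -> : E2 (z, u) = 0.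
      rewrite /E2 /=; apply/eqP; rewrite mulf_eq0 conjc_eq0; apply/orP.
      by move/not_andP : SS => [Sx|Sy]; [left|right]; rewrite E_outS.
    over.
  by rewrite integral_meas_cst mul0r.
rewrite cpatch_in// /gram (integral_meas_full _ mL L0).
apply: eq_integral_meas => u; rewrite /E2 /=.
have [Lu|Lu] := pselect (L u); first by rewrite cpatch_in// !E_in.
by rewrite cpatch_out// !E_outL// mul0r.
Qed.

Lemma bounded_gram : bounded_cmfun (cpatch (S `*` S) (fun z => gram z.1 z.2)).
Proof.
have := bounded_cmfun_integral1 nu bE2; congr bounded_cmfun.
by apply/funext => z; rewrite gram_patch.
Qed.

(** Both sides are iterated integrals of [e x u * conj(e y u)], in the two
    orders. Off [S] and [L] the kernel is replaced by 0, to have a measurable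
    integrand. *)
Lemma integral_transform_gram p q : p (~` S) = 0%E -> q (~` S) = 0%E ->
  integral_meas nu (fun u =>
    integral_meas p (e^~ u) * (integral_meas q (e^~ u))^*%C) =
  integral_meas (fin_prod p q) (fun z => gram z.1 z.2).
Proof.
move=> p0 q0; have pq0 := fin_prod_full mS mS p0 q0.
rewrite (integral_meas_full _ (measurableX mS mS) pq0).
under [RHS]eq_integral_meas do rewrite gram_patch.
rewrite -integral_meas_prod1// integral_meas_prod2//.
rewrite (integral_meas_full _ mL L0); apply: eq_integral_meas => u.
have bEu := bounded_cmfun_section2 be u.
rewrite /E2 (integral_meas_tensor p q (f := fun x => E (x, u))
  (g := fun y => (E (y, u))^*%C)) ?integral_measJ//; last first.
  exact: bounded_cmfunJ.
rewrite -!transform_patch//.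
have [Lu|Lu] := pselect (L u); first by rewrite !cpatch_in.
by rewrite !cpatch_out// mul0r.
Qed.

Lemma L2norm_transform (I : finType) (z : I -> R[i])
    (p : I -> {finite_measure set T -> \bar R}) :
  (forall k, p k (~` S) = 0%E) ->
  (L2norm nu (fun u => (\sum_k z k * integral_meas (p k) (e^~ u))%R) ^+ 2)%:C =
  \sum_k \sum_l z k * (z l)^*%C *
    integral_meas (fin_prod (p k) (p l)) (fun z => gram z.1 z.2).
Proof.
move=> p0; pose F k := cpatch L (fun u => integral_meas (p k) (e^~ u)).
have bF k : bounded_cmfun (F k) by exact: bounded_transform.
have bzF k : bounded_cmfun (fun u => z k * F k u).
  by apply: bounded_cmfunM => //; exact: bounded_cmfun_cst.
have patchF u : cpatch L (fun u => \sum_k z k * integral_meas (p k) (e^~ u)) u =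
    \sum_k z k * F k u.
  have [Lu|Lu] := pselect (L u).
    by rewrite cpatch_in//; apply: eq_bigr => k _; rewrite /F cpatch_in.
  by rewrite cpatch_out// big1// => k _; rewrite /F cpatch_out// mulr0.
have bsum : bounded_cmfun (cpatch L (fun u => \sum_k z k * integral_meas (p k) (e^~ u))).
  have [+ _] := integral_meas_sum nu (index_enum I) bzF.
  by congr bounded_cmfun; apply/funext => u; rewrite patchF.
rewrite (L2norm_sqr mL L0 bsum) (integral_meas_full _ mL L0).
have bFF k l : bounded_cmfun (fun u => F k u * (F l u)^*%C).
  exact/bounded_cmfunM/bounded_cmfunJ.
have bzFF k l : bounded_cmfun (fun u => z k * (z l)^*%C * (F k u * (F l u)^*%C)).
  by apply: bounded_cmfunM => //; exact: bounded_cmfun_cst.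
rewrite (@eq_integral_meas _ _ _ _ _ (fun u => \sum_k \sum_l
    (z k * (z l)^*%C) * (F k u * (F l u)^*%C))); last first.
  move=> u; have [Lu|Lu] := pselect (L u); last first.
    rewrite cpatch_out// big1// => k _; rewrite big1// => l _.
    by rewrite /F cpatch_out// mul0r mulr0.
  rewrite cpatch_in//; have := patchF u; rewrite cpatch_in// => ->.
  rewrite rmorph_sum big_distrlr; apply: eq_bigr => k _; apply: eq_bigr => l _ /=.
  by rewrite rmorphM /= mulrACA.
have bs k := (integral_meas_sum nu (index_enum I) (bzFF k)).
have [_ ->] := integral_meas_sum nu (index_enum I) (fun k => (bs k).1).
apply: eq_bigr => k _; rewrite (bs k).2; apply: eq_bigr => l _.
rewrite integral_measZ// -integral_transform_gram//; congr (_ * _).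
rewrite [RHS](integral_meas_full _ mL L0); apply: eq_integral_meas => u.
have [Lu|Lu] := pselect (L u); first by rewrite /F !cpatch_in.
by rewrite /F !cpatch_out// mul0r.
Qed.

End gram.

(** * Compact exhaustion and product measurability *)

Section borel_sets.
Context (G : lcaGroupType).

Lemma borel_open (U : set G) : open U -> measurable (U : set (borel G)).
Proof. exact: sub_sigma_algebra. Qed.

Lemma borel_closed (U : set G) : closed U -> measurable (U : set (borel G)).
Proof.
move=> cU; rewrite -[U]setCK; apply: measurableC; apply: borel_open.
exact: closed_openC.
Qed.

Lemma borel_compact (K : set G) : compact K -> measurable (K : set (borel G)).
Proof.
by move=> cK; apply: borel_closed; exact: compact_closed (@lca_hausdorff G) cK.
Qed.

Lemma borel_set1 (a : G) : measurable ([set a] : set (borel G)).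
Proof. by apply: borel_compact; exact: compact_set1. Qed.

Lemma borel_countable (A : set G) : countable A -> measurable (A : set (borel G)).
Proof. exact: (@countable_measurable _ (borel G) A (@borel_set1)). Qed.

End borel_sets.

Section sigma_compact.
Context (G : lcaGroupType) (R : realType).

Definition sigma_compact_borel (S : set (borel G)) :=
  exists2 K : nat -> set G, forall n, compact (K n) & S = \bigcup_n K n.

Lemma sigma_compact_measurable S : sigma_compact_borel S -> measurable S.
Proof.
move=> [K cK ->]; apply: bigcup_measurable => n _; exact: borel_compact.
Qed.

Lemma sigma_compact1 (g : G) : sigma_compact_borel [set g].
Proof.
exists (fun=> [set g]); first by move=> _; exact: compact_set1.
by rewrite bigcup_const//; exists 0%N.
Qed.

Lemma sigma_compactU S S' :
  sigma_compact_borel S -> sigma_compact_borel S' -> sigma_compact_borel (S `|` S').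
Proof.
move=> [K cK ->] [K' cK' ->]; exists (fun n => K n `|` K' n).
  by move=> n; exact: compactU.
by rewrite bigcupU.
Qed.

(** Take the union of compact sets with complements of measure less than
    [1/(n+1)]. *)
Lemma inner_regular_sigma_compact (m : {measure set (borel G) -> \bar R}) :
  inner_regular m -> exists2 S, sigma_compact_borel S & m (~` S) = 0%E.
Proof.
move=> rm; have e0 n : 0 < n.+1%:R^-1 :> R by rewrite invr_gt0.
have /choice[K KP] n := rm setT measurableT _ (e0 n).
exists (\bigcup_n K n); first by exists K => // n; have [] := KP n.
have mK n : measurable (K n : set (borel G)).
  by apply: borel_compact; have [] := KP n.
apply/eqP; rewrite eq_le measure_ge0 andbT.
apply/lee_addgt0Pr => e e_gt0; rewrite add0e.
have [n ne] : exists n : nat, n.+1%:R^-1 < e.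
  exists (Num.trunc e^-1); rewrite invf_plt// ?posrE//.
  by rewrite truncnS_gt.
have [_ _ mKn] := KP n.
apply: (@le_trans _ _ (m (setT `\` K n))).
  rewrite le_measure ?inE//.
  - by apply: measurableC; exact: bigcup_measurable.
  - exact: measurableD.
  - by move=> x nKx; split => // Kx; apply: nKx; exists n.
by apply: ltW; apply: lt_trans mKn _; rewrite lte_fin.
Qed.

End sigma_compact.

Section measurable_on_compacts.
Context (R : realType) (G H : lcaGroupType) (f : G -> H -> R).

(** [f] is within [e] of its value at [(g, h)] on the part of the open
    rectangle [UV] inside [K * L]: continuity at the point [(g, h)] relative
    to [K * L]. *)
Definition uniformly_close (K : set G) (L : set H) (e : R) g h
    (UV : set G * set H) :=
  [/\ open UV.1, open UV.2, UV.1 g, UV.2 h & forall g' h',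
    UV.1 g' -> K g' -> UV.2 h' -> L h' -> `|f g' h' - f g h| < e].

(** For each [n] the compact set [K * L] is covered by finitely many open
    rectangles on each of which [f] is within [1/(n+1)] of its value at a
    marked point [w]. The set where [a < f] is the union, over all [n], of
    those rectangles for which [a + 1/(n+1) < f w]: rectangles belong to
    the product sigma-algebra, whereas an arbitrary open set of the
    product need not. *)
Let measurable_compact (K : set G) (L : set H) : compact K -> compact L ->
  (forall e g h, 0 < e -> K g -> L h ->
    exists UV, uniformly_close K L e g h UV) ->
  measurable_fun (K `*` L : set (borel G * borel H))
    (fun z : borel G * borel H => f z.1 z.2).
Proof.
move=> cK cL fUV.
have mKL : measurable (K `*` L : set (borel G * borel H)).
  by apply: measurableX; exact: borel_compact.
apply: (measurability _ (RGenOInfty.measurableE R)) => //.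
move=> _ [_ [a ->] <-].
pose e n : R := n.+1%:R^-1; have e0 n : 0 < e n by rewrite invr_gt0.
have cover n : exists (F : seq (G * H)) (UV : G * H -> set G * set H),
    (forall z, z \in F -> uniformly_close K L (e n) z.1 z.2 (UV z)) /\
    (forall z, K z.1 -> L z.2 -> exists2 w, w \in F &
      (UV w).1 z.1 /\ (UV w).2 z.2).
  have /choice[UV UVP] (z : G * H) : exists uv, K z.1 -> L z.2 ->
      uniformly_close K L (e n) z.1 z.2 uv.
    have [[Kz Lz]|KLz] := pselect (K z.1 /\ L z.2).
      by have [uv] := fUV _ _ _ (e0 n) Kz Lz; exists uv.
    by exists (setT, setT) => Kz Lz; exfalso; exact: KLz.
  (* The point only serves to apply the finite cover form of compactness. *)
  pose GH : ptopologicalType :=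
    HB.pack (G * H)%type (isPointed.Build (G * H)%type (0, 0)).
  have : @compact GH (K `*` L) by exact: compact_setX cK cL.
  rewrite compact_cover.
  move=> /(_ (G * H)%type (K `*` L) (fun z => (UV z).1 `*` (UV z).2)).
  case.
  - move=> z [Kz Lz]; have [oU oV _ _ _] := UVP z Kz Lz.
    rewrite openE => -[g h] [/= Ug Vh].
    by exists ((UV z).1, (UV z).2) => //; split; exact: open_nbhs_nbhs.
  - by move=> z [Kz Lz]; exists z => //; have [] := UVP z Kz Lz.
  move=> F FKL KLF; exists (finmap.enum_fset F), UV; split.
    by move=> z /FKL; rewrite inE => -[Kz Lz]; exact: UVP.
  by move=> z Kz Lz; have [w wF wUV] := KLF z (conj Kz Lz); exists w.
have /choice[F /choice[UV FUV]] := cover.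
pose W := \bigcup_n \bigcup_(w in [set w | w \in F n /\ a + e n < f w.1 w.2])
  (((UV n w).1 `&` K) `*` ((UV n w).2 `&` L)).
suff -> : K `*` L `&` (fun z : borel G * borel H => f z.1 z.2) @^-1` `]a, +oo[ = W.
  apply: bigcup_measurable => n _; apply: fin_bigcup_measurable.
    by apply: (sub_finite_set _ (finite_seq (F n))) => w [].
  move=> w [wF _]; have [oU oV _ _ _] := (FUV n).1 w wF.
  by apply: measurableX; apply: measurableI; do ?[exact: borel_open | exact: borel_compact].
apply/seteqP; split.
- move=> [g h] /= [[Kg Lh]]; rewrite in_itv/= andbT => af.
  (* At a point with [2 / (n+1) < f - a] the value at the mark still exceeds [a
     + 1/(n+1)]. *)
  have [n en] : exists n, e n < (f g h - a) / 2.
    exists (Num.trunc ((f g h - a) / 2)^-1); rewrite invf_plt ?posrE//.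
      by rewrite truncnS_gt.
    by rewrite divr_gt0// subr_gt0.
  have [w wF [Ug Vh]] := (FUV n).2 (g, h) Kg Lh.
  exists n => //; exists w => //; split=> //.
  have [_ _ _ _ /(_ g h Ug Kg Vh Lh)] := (FUV n).1 w wF.
  by rewrite ltr_norml; lra.
- move=> [g h] /= [n _ [w /= [wF aw]] [[Ug Kg] [Vh Lh]]]; split => //.
  rewrite in_itv /= andbT.
  have [_ _ _ _ /(_ g h Ug Kg Vh Lh)] := (FUV n).1 w wF.
  by rewrite ltr_norml; lra.
Qed.

Lemma measurable_sigma_compact (S : set (borel G)) (L : set (borel H)) :
  sigma_compact_borel S -> sigma_compact_borel L ->
  (forall (K : set G) (K' : set H) e g h, compact K -> compact K' -> 0 < e ->
    K g -> K' h -> exists UV, uniformly_close K K' e g h UV) ->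
  measurable_fun (S `*` L) (fun z : borel G * borel H => f z.1 z.2).
Proof.
move=> [K cK ->] [K' cK' ->] fP.
have -> : (\bigcup_n K n) `*` (\bigcup_n K' n) =
    \bigcup_n \bigcup_m (K n `*` K' m) :> set (borel G * borel H).
  apply/seteqP; split => [[g h] [[n _ Kg] [m _ Kh]]|[g h] [n _ [m _ [Kg Kh]]]].
    by exists n => //; exists m.
  by split; [exists n|exists m].
have mKK n m : measurable (K n `*` K' m : set (borel G * borel H)).
  by apply: measurableX; exact: borel_compact.
apply/measurable_fun_bigcup => [n|n].
  by apply: bigcup_measurable => m _.
apply/measurable_fun_bigcup => [m|m] //.
by apply: measurable_compact => // e g h e0 Kg Lh; exact: fP.
Qed.

End measurable_on_compacts.

(** * The duality pairing *)

Section pairing.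
Context (R : realType) (G H : lcaGroupType) (psi : dual_pair R G H).

Let character h : is_character (dual_fun (psi h)).
Proof. exact: svalP (psi h). Qed.

Lemma pairingD x y h : pairing psi (x + y) h = pairing psi x h * pairing psi y h.
Proof. by have [_ + _] := character h; apply. Qed.

Lemma norm_pairing g h : `|pairing psi g h| = 1.
Proof. by have [_ _] := character h; apply. Qed.

Lemma pairing0 h : pairing psi 0 h = 1.
Proof.
have p0 : pairing psi 0 h != 0 by rewrite -normr_eq0 norm_pairing oner_eq0.
by apply: (mulfI p0); rewrite -pairingD addr0 mulr1.
Qed.

Lemma pairingN g h : pairing psi (- g) h = (pairing psi g h)^*%C.
Proof.
have p0 : pairing psi g h != 0 by rewrite -normr_eq0 norm_pairing oner_eq0.
by apply: (mulfI p0); rewrite -pairingD subrr pairing0 -sqr_normc norm_pairing expr1n.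
Qed.

Lemma pairingB x y h : pairing psi (x - y) h = pairing psi x h * (pairing psi y h)^*%C.
Proof. by rewrite pairingD pairingN. Qed.

Let dual_fun_continuous : continuous (fun h : H => dual_fun (psi h)).
Proof.
move=> h; apply: (@continuous_comp _ _ _ psi (@dual_fun R G)).
  exact: dual_iso_continuous.
exact: initial_continuous.
Qed.

(** Joint continuity of the pairing on [K * H]. Near [g] and [h] the values
    [<g', h>] with [g'] in [K] stay in a closed set [closure B] inside the ball
    [O]; these [g'] form a compact set, so mapping it into [O] is an open
    condition on characters in the compact-open topology. *)
Lemma pairing_close (K : set G) (g : G) (h : H) (e : R) : compact K -> 0 < e ->
  exists UV : set G * set H, [/\ open UV.1, open UV.2, UV.1 g, UV.2 h &
    forall g' h', UV.1 g' -> K g' -> UV.2 h' ->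
      modulus (pairing psi g h - pairing psi g' h') < e].
Proof.
move=> cK e0; pose chi : G -> R[i]^o := dual_fun (psi h).
have cchi : continuous chi by have [] := character h.
pose O : set R[i]^o := interior [set z : R[i]^o | `|chi g - z| < e%:C].
have Oz : nbhs (chi g) O.
  apply: nbhs_interior; apply: (@nbhsx_ballx _ _ (chi g) e%:C).
  by rewrite ltcR.
have [B nB BO] := uniform_regular Oz.
have cK' : compact (K `&` chi @^-1` (closure B)).
  apply: compact_closedI => //; apply: closed_comp; last exact: closed_closure.
  by move=> x _; exact: cchi.
exists (interior (chi @^-1` B), (fun h => dual_fun (psi h)) @^-1`
  [set u : {compact-open, G -> R[i]^o} |
    u @` (K `&` chi @^-1` (closure B)) `<=` O]); split => /=.
- exact: open_interior.
- apply: open_comp; first by move=> x _; exact: dual_fun_continuous.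
  exact: (compact_open_open cK' (@open_interior _ _)).
- exact: (cchi g).
- by move=> _ [x [_ Bx] <-]; exact: BO.
- move=> g' h' /interior_subset Bg' Kg' h'O.
  rewrite -ltcR /modulus normc_def /= -normc_def.
  apply: (@interior_subset _ [set z : R[i]^o | `|chi g - z| < e%:C]).
  by apply: h'O; exists g' => //; split => //; exact: subset_closure.
Qed.

(** The pairing is measurable for the product of the Borel sigma-algebras once
    it is restricted to sigma-compact sets. *)
Lemma bounded_pairing (S : set (borel G)) (L : set (borel H)) :
  sigma_compact_borel S -> sigma_compact_borel L ->
  bounded_cmfun (cpatch (S `*` L) (fun z : borel G * borel H => pairing psi z.1 z.2)).
Proof.
move=> sS sL.
have mSL : measurable (S `*` L) by apply: measurableX; exact: sigma_compact_measurable.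
have modulus1 g h : modulus (pairing psi g h) = 1 by rewrite /modulus norm_pairing.
have part_close (P : R[i] -> R) (PB : forall x y, P (x - y) = P x - P y)
    (Ple : forall z, `|P z| <= modulus z) :
    (forall (K : set G) (K' : set H) e g h, compact K -> compact K' -> 0 < e ->
    K g -> K' h -> exists UV,
      uniformly_close (fun g h => P (pairing psi g h)) K K' e g h UV).
  move=> K K' e g h cK _ e0 _ _; have [UV [oU oV Ug Vh UVe]] := pairing_close g h cK e0.
  exists UV; split => // g' h' Ug' Kg' Vh' _.
  by rewrite distrC -PB (le_lt_trans (Ple _))// UVe.
have bounded_part (f : G -> H -> R) : (forall g h, `|f g h| <= 1) ->
    measurable_fun (S `*` L) (fun z : borel G * borel H => f z.1 z.2) ->
    bounded_mfun (patch (fun=> 0) (S `*` L) (fun z : borel G * borel H => f z.1 z.2)).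
  move=> f1 mf; split; first exact/(measurable_restrictT _ mSL).
  by exists 1 => z; rewrite /patch; case: ifP => // _; rewrite normr0.
split.
  under eq_fun do rewrite Re_cpatch.
  apply: (@bounded_part (fun g h => complex.Re (pairing psi g h))).
    by move=> g h; rewrite -(modulus1 g h) norm_Re_le.
  apply: (@measurable_sigma_compact _ _ _ (fun g h => complex.Re (pairing psi g h))) => //.
  apply: (part_close (@complex.Re R)); last exact: norm_Re_le.
  by move=> x y; rewrite ReD ReN.
under eq_fun do rewrite Im_cpatch.
apply: (@bounded_part (fun g h => complex.Im (pairing psi g h))).
  by move=> g h; rewrite -(modulus1 g h) norm_Im_le.
apply: (@measurable_sigma_compact _ _ _ (fun g h => complex.Im (pairing psi g h))) => //.
apply: (part_close (@complex.Im R)); last exact: norm_Im_le.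
by move=> x y; rewrite ImD ImN.
Qed.

End pairing.

(** * Countable sets, atoms and the diagonal *)

Lemma countable_trivIset T (C : set T) : countable C ->
  exists K : nat -> set T, [/\ C = \bigcup_n K n, trivIset setT K &
    forall n, K n = set0 \/ exists2 a, C a & K n = [set a]].
Proof.
move=> /countable_injP[j injj]; exists (fun n => C `&` j @^-1` [set n]); split.
- apply/seteqP; split => [a Ca|a [n _ []]//]; by exists (j a).
- by apply/trivIsetP => m n _ _; apply: contraNeq => /set0P[x [[_ <-] [_ <-]]].
- move=> n; have [->|/set0P[a [Ca an]]] := eqVneq (C `&` j @^-1` [set n]) set0.
    by left.
  right; exists a => //; apply/seteqP; split => [b [Cb bn]|_ ->]//=.
  exact: injj (mem_set Cb) (mem_set Ca) (etrans bn (esym an)).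
Qed.

Section countable_sets.
Context d (T : measurableType d) (R : realType).
Hypothesis mset1 : forall a : T, measurable [set a].
Implicit Types (m p q : {finite_measure set T -> \bar R}) (C : set T).

Lemma countable_null (m : {measure set T -> \bar R}) C : countable C ->
  (forall a, C a -> m [set a] = 0%E) -> m C = 0%E.
Proof.
move=> cC C0; have mC := countable_measurable mset1 cC.
have [K [CK _ K1]] := countable_trivIset cC.
apply/(negligibleP _ mC); rewrite CK; apply: negligible_bigcup => n.
have [->|[a Ca ->]] := K1 n; first exact: negligible_set0.
by apply/negligibleP => //; exact: C0.
Qed.

(** A finite measure has at most [(n+1) m(T)] points of mass larger than
    [1/(n+1)]. *)
Lemma countable_atoms m : countable [set a | m [set a] != 0%E].
Proof.
pose A n := [set a | (n.+1%:R^-1%:E < m [set a])%E].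
have -> : [set a | m [set a] != 0%E] = \bigcup_n A n.
  apply/seteqP; split => [a /= ma0|a [n _]]; last first.
    by apply: contraTneq => ->; rewrite -leNgt lee_fin invr_ge0.
  have ma_gt0 : (0 < m [set a])%E by rewrite lt0e ma0 measure_ge0.
  have := fin_num_measure m _ (mset1 a).
  move: ma_gt0; rewrite /A /bigcup /=; move: (m [set a]) => [r| |]//.
  rewrite lte_fin => r0 _; exists (Num.trunc r^-1) => //.
  by rewrite lte_fin invf_plt ?posrE// truncnS_gt.
apply: bigcup_countable => // n _; apply: finite_set_countable.
apply: contrapT => /infinite_set_fset infA.
have [r mT] : exists r, m setT = r%:E.
  by exists (fine (m setT)); rewrite fineK// fin_num_measure.
have [B BA cB] := infA (Num.trunc (n.+1%:R * r)).+1.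
have mB : (m [set` B] <= r%:E)%E.
  rewrite -mT; apply: le_measure => //; apply: mem_set => //.
  exact: (countable_measurable mset1 (countable_fset B)).
have BE : [set` B] = \big[setU/set0]_(a <- B) [set a].
  by rewrite -bigcup_fset bigcup_imset1 image_id.
have : (\sum_(a <- B) m [set a] <= r%:E)%E.
  rewrite -(measure_fbigsetU m (F := fun a => [set a]))// -?BE//.
  by apply/trivIsetP => a b _ _; apply: contraNeq => /set0P[x [/= -> ->]].
apply/negP; rewrite -ltNge.
apply: (@lt_le_trans _ _ (\sum_(a <- B) n.+1%:R^-1%:E)%E); last first.
  rewrite !big_seq; apply: lee_sum => a aB; apply: ltW; exact: BA.
rewrite sumEFin lte_fin big_const_seq count_predT iter_addr_0.
rewrite -[X in X < _](mulKf (_ : n.+1%:R != 0 :> R))// -[X in _ < X]mulr_natr.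
rewrite ltr_pM2l ?invr_gt0//.
apply: lt_le_trans (_ : (Num.trunc (n.+1%:R * r)).+1%:R <= _).
  exact: truncnS_gt.
by rewrite ler_nat.
Qed.

(** Integration of a function supported by a countable set is summation; in the
    form of an unordered sum, no enumeration appears in the result. *)
Lemma integral_countable m C (f : T -> \bar R) : countable C ->
  (forall x, 0 <= f x)%E -> (forall x, ~ C x -> f x = 0%E) -> measurable_fun setT f ->
  (\int[m]_x f x = \esum_(a in C) (f a * m [set a]))%E.
Proof.
move=> cC f0 fC mf; have [K [CK tK K1]] := countable_trivIset cC.
have mK n : measurable (K n) by have [->|[a _ ->]] := K1 n.
transitivity (\int[m]_(x in C) f x)%E.
  rewrite [RHS]integral_mkcond; apply: eq_integral => x _.
  rewrite /patch; case: ifPn => // /negP; rewrite inE => Cx; exact: fC.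
rewrite CK ge0_integral_bigcup//; last exact: measurable_funTS.
rewrite nneseries_sum_bigcup//; last by move=> a; rewrite mule_ge0.
apply: eq_eseriesr => n _; have [->|[a _ ->]] := K1 n.
  by rewrite integral_set0 esum_set0.
rewrite esum_set1 ?mule_ge0// (eq_integral (cst (f a))); last first.
  by move=> x; rewrite inE => /= ->.
by rewrite integral_cst.
Qed.

End countable_sets.

Section almost_everywhere.
Context d (T : measurableType d) (R : realType).

(** The function [1 - Re f >= 0] has integral 0, so [Re f = 1] almost
    everywhere, and a complex number of modulus at most 1 with real
    part 1 is 1. *)
Lemma integral_eq1_ae (m : {finite_measure set T -> \bar R}) D (f : T -> R[i]) :
  m setT = 1%E -> measurable D -> m (~` D) = 0%E -> bounded_cmfun (cpatch D f) ->
  (forall x, D x -> modulus (f x) <= 1) -> complex.Re (integral_meas m f) = 1 ->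
  exists E, [/\ measurable E, E `<=` D, m (~` E) = 0%E & forall x, E x -> f x = 1].
Proof.
move=> m1 mD D0 bf f1 intf; pose g x := complex.Re (cpatch D f x).
have bg : bounded_mfun g by have [] := bf.
have b1g : bounded_mfun (fun x => 1 - g x).
  exact: bounded_mfunB (bounded_mfun_cst _ 1) bg.
have g1 x : g x <= 1.
  rewrite /g; have [Dx|Dx] := pselect (D x); last by rewrite cpatch_out.
  by rewrite cpatch_in// (le_trans (ler_norm _))// (le_trans (norm_Re_le _))// f1.
have int0 : \int[m]_x (1 - g x) = 0.
  rewrite (RintegralB measurableT).
  - rewrite Rintegral_cst// [X in fine X]m1 mulr1 -intf.
    by rewrite (integral_meas_full _ mD D0) subrr.
  - exact: bounded_mfun_integrable (bounded_mfun_cst _ 1).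
  - exact: bounded_mfun_integrable.
have : (\int[m]_x `|(1 - g x)%:E| = 0)%E.
  under eq_integral do rewrite gee0_abs ?lee_fin ?subr_ge0//.
  have /fineK <- := integrable_fin_num measurableT (bounded_mfun_integrable m b1g).
  by rewrite [X in X%:E]int0.
move=> /ae_eq_integral_abs -/(_ measurableT) [].
  by apply/measurable_EFinP; case: b1g.
move=> N [mN N0 Ng]; exists (D `\` N); split.
- exact: measurableD.
- by move=> x [].
- rewrite setCD; apply: (null_set_setU _ _ D0 N0) => //.
  exact: measurableC.
move=> x [Dx Nx]; have gx : g x = 1.
  apply: contrapT => gx; apply: Nx; apply: Ng => /= /(_ I) [/eqP].
  by rewrite subr_eq0 => /eqP /esym.
move: gx; rewrite /g cpatch_in// => rf; apply: eq_ReIm; first by rewrite rf.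
have := f1 x Dx; rewrite -(@expr_le1 _ 2)// ?modulus_ge0// modulus_sqr rf expr1n.
rewrite gerDl => i0; apply/eqP; rewrite -sqrf_eq0; apply/eqP/le_anti.
by rewrite i0 sqr_ge0.
Qed.

(** Holds for every function, as a Dirac measure is carried by its point. *)
Lemma integral_dirac_point (a : T) (f : T -> R[i]) : measurable [set a] ->
  integral_meas (dirac a : {measure set T -> \bar R}) f = f a.
Proof.
move=> ma; have a0 : dirac a (~` [set a]) = 0%E :> \bar R.
  by rewrite diracE memNset//=; apply.
rewrite (integral_meas_full _ ma a0).
transitivity (integral_meas (dirac a : {measure set T -> \bar R})
  (cpatch [set a] (fun=> f a))).
  apply: eq_integral_meas => x; have [xa|xa] := pselect ([set a] x).
    by rewrite !cpatch_in// xa.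
  by rewrite !cpatch_out.
rewrite -(integral_meas_full _ ma a0).
rewrite (integral_meas_cst (dirac a : {finite_measure set T -> \bar R})).
by rewrite [X in fine X]diracT mulr1.
Qed.

End almost_everywhere.

Section product_null_sets.
Context d1 d2 (T1 : measurableType d1) (T2 : measurableType d2) (R : realType).
Variables (p : {finite_measure set T1 -> \bar R})
  (q : {finite_measure set T2 -> \bar R}).

(** The measures of the sections have integral 0, so almost all of them vanish;
    [p != 0] provides one. *)
Lemma null_section (N : set (T1 * T2)) : measurable N -> p setT != 0%E ->
  fin_prod p q N = 0%E -> exists x, q (xsection N x) = 0%E.
Proof.
move=> mN p0 N0.
have mf : measurable_fun setT (q \o xsection N) by exact: measurable_fun_xsection.
have : (\int[p]_x `|(q \o xsection N) x| = 0)%E.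
  by rewrite -[RHS]N0; apply: eq_integral => x _; rewrite gee0_abs.
move=> /ae_eq_integral_abs -/(_ measurableT mf) [M [mM M0 MN]].
apply: contrapT => noq; move/eqP: p0; apply.
apply: subset_measure0 M0 => // x _; apply: MN => /= /(_ I) qx.
by apply: noq; exists x.
Qed.

End product_null_sets.

Section diagonal.
Context d (T : measurableType d) (R : realType).
Hypothesis mset1 : forall a : T, measurable [set a].

(** The section of the diagonal at [x] is [{x}], so the measure of the diagonal
    is the integral of the function [q{x}], supported by the countable set of
    atoms of [q]. The diagonal is taken over a set [S] of full measure because
    the whole diagonal may fail to be in the product sigma-algebra. *)
Lemma fin_prod_diagonal (p q : {finite_measure set T -> \bar R}) S C :
  measurable S -> q (~` S) = 0%E ->
  measurable [set z : T * T | S z.1 /\ z.1 = z.2] ->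
  countable C -> [set a | q [set a] != 0%E] `<=` C ->
  fin_prod p q [set z | S z.1 /\ z.1 = z.2] =
    (\esum_(a in C) (p [set a] * q [set a]))%E.
Proof.
move=> mS S0 mD cC qC; set D := [set z | _].
have sectionE x : q (xsection D x) = q [set x].
  have [Sx|Sx] := pselect (S x).
    congr (q _); apply/seteqP; split => y; rewrite /xsection/= inE /D/=.
      by case.
    by move=> ->.
  have -> : xsection D x = set0.
    by apply/seteqP; split => y //; rewrite /xsection/= inE /D/= => -[].
  rewrite measure0; apply/esym; apply: subset_measure0 S0 => //.
    exact: measurableC.
  by move=> _ ->.
under eq_esum do rewrite muleC.
rewrite -(integral_countable mset1 (f := fun a => q [set a]) _ cC)//.
- by apply: eq_integral => x _; exact: sectionE.
- by move=> x Cx; apply/eqP; apply: contra_notT Cx; exact: qC.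
- have := measurable_fun_xsection q mD.
  by congr measurable_fun; apply/funext => x; exact: sectionE.
Qed.

End diagonal.

(** * Means of characters *)

Section mean_square.
Context (R : realType) (G H : lcaGroupType) (psi : dual_pair R G H).
Variables (nu : nat -> probability (borel H) R).
Hypothesis nu_reg : forall N, inner_regular (nu N).

Local Notation mean := (mean_seq psi nu).
Local Notation mean_diff := (fun N (z : borel G * borel G) => mean (z.1 - z.2 : G) N).

Lemma sigma_compact_countable (C : set (borel G)) : countable C -> sigma_compact_borel C.
Proof.
move=> /countable_trivIset[K [-> _ K1]]; exists K => // n.
by have [->|[a _ ->]] := K1 n; [exact: compact0|exact: compact_set1].
Qed.

Let bounded_pairing1 (L : set (borel H)) (g : G) : sigma_compact_borel L ->
  bounded_cmfun (cpatch L (pairing psi g)).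
Proof.
move=> sL; have b := bounded_pairing psi (sigma_compact1 g) sL.
have := bounded_cmfun_section1 b (g : borel G); congr bounded_cmfun.
apply/funext => h; have [Lh|Lh] := pselect (L h); first by rewrite !cpatch_in.
by rewrite !cpatch_out// => -[].
Qed.

Lemma bounded_pairing2 (S : set (borel G)) (h : H) : sigma_compact_borel S ->
  bounded_cmfun (cpatch S (fun g : borel G => pairing psi g h)).
Proof.
move=> sS; have b := bounded_pairing psi sS (sigma_compact1 h).
have := bounded_cmfun_section2 b (h : borel H); congr bounded_cmfun.
apply/funext => g; have [Sg|Sg] := pselect (S g); first by rewrite !cpatch_in.
by rewrite !cpatch_out// => -[].
Qed.

Lemma mean_le1 g N : modulus (mean g N) <= 1.
Proof.
have [L sL L0] := inner_regular_sigma_compact (nu_reg N).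
have mL := sigma_compact_measurable sL.
rewrite /mean_seq (integral_meas_full _ mL L0); apply: integral_meas_le1.
  exact: bounded_pairing1.
move=> h; have [Lh|Lh] := pselect (L h).
  by rewrite cpatch_in// /modulus norm_pairing.
by rewrite cpatch_out// /modulus normr0.
Qed.

Lemma mean0 N : mean 0 N = 1.
Proof.
rewrite /mean_seq (@eq_integral_meas _ _ _ _ _ (fun=> 1)); last exact: pairing0.
rewrite (integral_meas_cst (nu N : {finite_measure set _ -> \bar R})).
by rewrite [X in fine X]probability_setT mulr1.
Qed.

Lemma meanN g N : mean (- g) N = (mean g N)^*%C.
Proof.
have [L sL L0] := inner_regular_sigma_compact (nu_reg N).
have mL := sigma_compact_measurable sL.
rewrite /mean_seq [LHS](integral_meas_full _ mL L0).
rewrite (integral_meas_full (pairing psi g : borel H -> R[i]) mL L0).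
rewrite -(integral_measJ (nu N : {finite_measure set _ -> \bar R})); last first.
  exact: bounded_pairing1.
apply: eq_integral_meas => h; have [Lh|Lh] := pselect (L h).
  by rewrite !cpatch_in// pairingN.
by rewrite !cpatch_out// conjc0.
Qed.

Let gram_mean N (x y : borel G) : gram (pairing psi : borel G -> borel H -> R[i]) (nu N) x y = mean (x - y : G) N.
Proof. by apply: eq_integral_meas => h; rewrite pairingB. Qed.

Lemma bounded_mean S N : sigma_compact_borel S ->
  bounded_cmfun (cpatch (S `*` S) (mean_diff N)).
Proof.
move=> sS; have [L sL L0] := inner_regular_sigma_compact (nu_reg N).
have mS := sigma_compact_measurable sS.
have mL := sigma_compact_measurable sL.
have := bounded_gram mL (bounded_pairing psi sS sL) L0; congr bounded_cmfun.
by congr cpatch; apply/funext => z; exact: gram_mean.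
Qed.

(** The Gram kernel of the characters is the mean at the difference. *)
Lemma mean_square_sum N S (I : finType) (z : I -> R[i])
    (p : I -> {finite_measure set (borel G) -> \bar R}) :
  sigma_compact_borel S -> (forall k, p k (~` S) = 0%E) ->
  (L2norm (nu N) (fun h => (\sum_k z k * integral_meas (p k) (fun g => pairing psi g h))%R)
     ^+ 2)%:C =
  \sum_k \sum_l z k * (z l)^*%C * integral_meas (fin_prod (p k) (p l)) (mean_diff N).
Proof.
move=> sS p0; have [L sL L0] := inner_regular_sigma_compact (nu_reg N).
have mS := sigma_compact_measurable sS.
have mL := sigma_compact_measurable sL.
rewrite (L2norm_transform mS mL (bounded_pairing psi sS sL) L0 z p0).
apply: eq_bigr => k _; apply: eq_bigr => l _.
apply: (congr1 (fun v => z k * (z l)^*%C * v)).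
by apply: eq_integral_meas => w; exact: gram_mean.
Qed.

(** Dominated convergence for the double integral of the means. The set
    [D] is a parameter because in the discrete case it consists of the
    pairs of atoms. *)
Lemma cvg_mean_integral (p q : {finite_measure set (borel G) -> \bar R}) S D
    (F : borel G * borel G -> R[i]) :
  sigma_compact_borel S -> measurable D -> D `<=` S `*` S ->
  fin_prod p q (~` D) = 0%E ->
  (forall z, D z -> (mean (z.1 - z.2 : G) : nat -> R[i]^o) @ \oo --> (F z : R[i]^o)) ->
  bounded_cmfun (cpatch D F) /\
  (fun N => integral_meas (fin_prod p q) (mean_diff N) : R[i]^o) @ \oo -->
    (integral_meas (fin_prod p q) F : R[i]^o).
Proof.
move=> sS mD DS D0 mF.
apply: (integral_meas_dominated (m := fin_prod p q) mD D0) => //.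
- by move=> N; exact: bounded_cmfun_patchS mD DS (bounded_mean N sS).
- by move=> N z _; exact: mean_le1.
Qed.

(** The inner regularity of the two total variations passes to the
    four parts. *)
Lemma cm_sigma_compact (mu : complex_measure (borel G) R) : cm_inner_regular mu ->
  exists2 S, sigma_compact_borel S & forall k, cm_part mu k (~` S) = 0%E.
Proof.
move=> [rre rim].
have [S sS S0] := inner_regular_sigma_compact rre.
have [S' sS' S0'] := inner_regular_sigma_compact rim.
have mS := sigma_compact_measurable sS.
have mS' := sigma_compact_measurable sS'.
have sSS := sigma_compactU sS sS'; have mSS := sigma_compact_measurable sSS.
exists (S `|` S') => // k.
have part0 (xi : {charge set (borel G) -> \bar R}) X : measurable X ->
    X `<=` S `|` S' -> charge_variation (hahn_posneg xi) (~` X) = 0%E ->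
    charge_pos xi (~` (S `|` S')) = 0%E /\ charge_neg xi (~` (S `|` S')) = 0%E.
  move=> mX XS /eqP; rewrite /charge_variation padde_eq0//.
  move=> /andP[/eqP p0 /eqP n0]; have mXC := measurableC mX.
  have mSC := measurableC mSS.
  have sub : ~` (S `|` S') `<=` ~` X by apply: subsetC.
  by split; [exact: subset_measure0 p0|exact: subset_measure0 n0].
have [p0 n0] := part0 _ _ mS (@subsetUl _ _ _) S0.
have [p0' n0'] := part0 _ _ mS' (@subsetUr _ _ _) S0'.
by move: k => [[] []].
Qed.

Lemma mean_square_cm N S (mu : complex_measure (borel G) R) :
  sigma_compact_borel S -> (forall k, cm_part mu k (~` S) = 0%E) ->
  (L2norm (nu N) (fourier psi mu) ^+ 2)%:C =
  \sum_k \sum_l cm_coef k * (cm_coef l)^*%C *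
    integral_meas (fin_prod (cm_part mu k) (cm_part mu l)) (mean_diff N).
Proof.
move=> sS mu0; rewrite -(mean_square_sum N _ sS mu0).
congr (_ %:C); congr (_ ^+ 2); congr L2norm; apply/funext => h.
by rewrite /fourier integral_cmE.
Qed.

(** The Jordan parts of a positive measure, obtained from an abstract Hahn
    decomposition, integrate as the measure itself. *)
Lemma integral_cm_of_prob (mu : probability (borel G) R) S (f : borel G -> R[i]) :
  measurable S -> mu (~` S) = 0%E -> bounded_cmfun (cpatch S f) ->
  integral_cm (cm_of_prob mu) f = integral_meas mu f.
Proof.
move=> mS S0 bf; rewrite /integral_cm /cm_of_prob /=.
have [_ ->] := integral_charge_measure (p := mu) mS S0 bf.
have -> : integral_charge (czero : {charge set (borel G) -> \bar R}) f = 0.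
  pose z : {finite_measure set (borel G) -> \bar R} := mzero.
  rewrite (@integral_charge_full _ _ _ S mS _ z z) ?subrr//.
  - apply: (charge_null_diff (p := z) (q := z)) => //; first exact: measurableC.
    by move=> A mA; rewrite /czero /z /mzero sube0.
  - by move=> A mA; rewrite /czero /z /mzero sube0.
by rewrite mulr0 addr0.
Qed.

Lemma mean_square_prob N S (mu : probability (borel G) R) :
  sigma_compact_borel S -> mu (~` S) = 0%E ->
  (L2norm (nu N) (fourier psi (cm_of_prob mu)) ^+ 2)%:C =
  integral_meas (fin_prod mu mu) (mean_diff N).
Proof.
move=> sS S0; have mS := sigma_compact_measurable sS.
have := @mean_square_sum N S 'I_1 (fun=> 1) (fun=> mu) sS (fun=> S0).
rewrite !big_ord1 conjc1 !mul1r => <-.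
congr (_ %:C); congr (_ ^+ 2); congr L2norm; apply/funext => h.
rewrite big_ord1 mul1r /fourier (integral_cm_of_prob mS S0)//.
exact: bounded_pairing2.
Qed.

End mean_square.

(** * Limits of mean squares *)

Section limits.
Context (R : realType) (G H : lcaGroupType) (psi : dual_pair R G H).
Variables (nu : nat -> probability (borel H) R).
Hypothesis nu_reg : forall N, inner_regular (nu N).

Local Notation mean := (mean_seq psi nu).
Local Notation c := (c_fun psi nu).

Lemma cvg_real_complex (u : nat -> R) (l : R[i]) :
  ((fun n => (u n)%:C : R[i]^o) @ \oo --> (l : R[i]^o)) ->
  u @ \oo --> complex.Re l.
Proof. by move=> /cvg_complexP[]. Qed.

Lemma cvg_complex_sum (I : finType) (z : I -> R[i]) (u : I -> nat -> R[i]) (l : I -> R[i]) :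
  (forall i, (u i : nat -> R[i]^o) @ \oo --> (l i : R[i]^o)) ->
  (fun n => \sum_i z i * u i n : R[i]^o) @ \oo --> (\sum_i z i * l i : R[i]^o).
Proof.
move=> ul.
have step (r : seq I) : (fun n => \sum_(i <- r) z i * u i n : R[i]^o) @ \oo -->
    (\sum_(i <- r) z i * l i : R[i]^o).
  elim: r => [|i r ih].
    by rewrite big_nil; under eq_fun do rewrite big_nil; exact: cvg_cst.
  rewrite big_cons; under eq_fun do rewrite big_cons.
  apply: (@cvgD _ R[i]^o) ih.
  by apply: (@cvgM R[i]^o); [exact: cvg_cst|exact: ul].
exact: step.
Qed.

Lemma good_c_at g : good psi nu -> c_at psi nu g (c g).
Proof. by move=> /(_ g). Qed.

Lemma c_at_unique g z z' : c_at psi nu g z -> c_at psi nu g z' -> z = z'.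
Proof. exact: (@cvg_unique _ (@norm_hausdorff _ R[i]^o)). Qed.

Lemma c_at_le1 g z : c_at psi nu g z -> modulus z <= 1.
Proof.
move=> /cvg_complexP[cr ci]; rewrite -(@expr_le1 _ 2)// ?modulus_ge0// modulus_sqr.
have : (fun N => complex.Re (mean g N) * complex.Re (mean g N) +
    complex.Im (mean g N) * complex.Im (mean g N)) @ \oo -->
    complex.Re z * complex.Re z + complex.Im z * complex.Im z.
  by apply: cvgD; apply: cvgM.
move=> /cvgr_to_le; apply; apply: nearW => N.
by rewrite -!expr2 -modulus_sqr expr_le1// ?modulus_ge0//; exact: mean_le1.
Qed.

Lemma c_at0 : c_at psi nu 0 1.
Proof.
by rewrite /c_at (_ : mean 0 = fun=> 1); [exact: cvg_cst|apply/funext => N; exact: mean0].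
Qed.

Lemma c_atN g z : c_at psi nu g z -> c_at psi nu (- g) z^*%C.
Proof.
move=> /cvg_complexP[cr ci]; apply/cvg_complexP; split.
  by under eq_fun do rewrite meanN// ReJ; rewrite ReJ.
by under eq_fun do rewrite meanN// ImJ; rewrite ImJ; exact: cvgN.
Qed.

Lemma cvg_mean_square_cm (mu : complex_measure (borel G) R) S
    (F : borel G * borel G -> R[i]) :
  sigma_compact_borel S -> (forall k, cm_part mu k (~` S) = 0%E) ->
  (forall z, c_at psi nu (z.1 - z.2 : G) (F z)) ->
  bounded_cmfun (cpatch (S `*` S) F) /\
  (fun N => (L2norm (nu N) (fourier psi mu) ^+ 2)%:C : R[i]^o) @ \oo -->
  (\sum_k \sum_l cm_coef k * (cm_coef l)^*%C *
    integral_meas (fin_prod (cm_part mu k) (cm_part mu l)) F : R[i]^o).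
Proof.
move=> sS mu0 cF; have mS := sigma_compact_measurable sS.
have mSS : measurable (S `*` S) by exact: measurableX.
have lim k l := @cvg_mean_integral _ _ _ psi nu nu_reg (cm_part mu k) (cm_part mu l)
  S (S `*` S) F sS mSS (@subset_refl _ _)
  (fin_prod_full mS mS (mu0 k) (mu0 l)) (fun z _ => cF z).
split; first by have [] := lim (true, true) (true, true).
under eq_fun do rewrite (mean_square_cm psi nu_reg _ sS mu0) pair_bigA.
rewrite pair_bigA; apply: cvg_complex_sum => -[k l] /=.
by have [] := lim k l.
Qed.

Lemma mean_square_cvg : good psi nu ->
  forall mu : complex_measure (borel G) R, cm_inner_regular mu ->
  (fun N => (L2norm (nu N) (fourier psi mu) ^+ 2)%:C : R[i]^o) @ \oo -->
    (integral_cm (prod_cm mu (cm_conj mu)) (fun p => c (p.1 - p.2)) : R[i]^o).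
Proof.
move=> gd mu rmu; have [S sS mu0] := cm_sigma_compact rmu.
have mS := sigma_compact_measurable sS.
have [bF lim] := @cvg_mean_square_cm mu S (fun z => c (z.1 - z.2 : G)) sS mu0
  (fun z => @good_c_at _ gd).
rewrite (@integral_prod_cm_conj _ _ _ mu (S `*` S)) => //.
  exact: measurableX.
by move=> k l; exact: fin_prod_full.
Qed.

Lemma cvg_mean_square_prob (mu : probability (borel G) R) S D
    (F : borel G * borel G -> R[i]) :
  sigma_compact_borel S -> mu (~` S) = 0%E ->
  measurable D -> D `<=` S `*` S -> fin_prod mu mu (~` D) = 0%E ->
  (forall z, D z -> c_at psi nu (z.1 - z.2 : G) (F z)) ->
  bounded_cmfun (cpatch D F) /\
  (fun N => L2norm (nu N) (fourier psi (cm_of_prob mu)) ^+ 2) @ \oo -->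
  complex.Re (integral_meas (fin_prod mu mu) F).
Proof.
move=> sS S0 mD DS D0 cF.
have [bF lim] := cvg_mean_integral nu_reg sS mD DS D0 cF.
split=> //; apply: cvg_real_complex.
by under eq_fun do rewrite (mean_square_prob psi nu_reg _ sS S0).
Qed.

Let prob_fin_prodT (mu : probability (borel G) R) : fin_prod mu mu setT = 1%E.
Proof.
by rewrite -setXTT [LHS]product_measure1E// [X in (X * _)%E]probability_setT
  [X in (_ * X)%E]probability_setT mule1.
Qed.

(** The integral of [c(x - y)] is the limit 1, while [|c| <= 1] as a limit of
    means of characters. *)
Lemma mean_square_cvg1_ae : good psi nu ->
  forall mu : probability (borel G) R, inner_regular mu ->
  (fun N => L2norm (nu N) (fourier psi (cm_of_prob mu)) ^+ 2) @ \oo --> (1 : R) ->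
  exists E : set (borel G * borel G), [/\ measurable E, fin_prod mu mu (~` E) = 0%E &
    forall z, E z -> c_at psi nu (z.1 - z.2 : G) 1].
Proof.
move=> gd mu rmu lim1; have [S sS S0] := inner_regular_sigma_compact rmu.
have mS := sigma_compact_measurable sS.
have mSS : measurable (S `*` S) by exact: measurableX.
have SS0 := fin_prod_full mS mS S0 S0.
have [bF lim] := @cvg_mean_square_prob mu S _ (fun z => c (z.1 - z.2 : G)) sS S0
  mSS (@subset_refl _ _) SS0 (fun z _ => @good_c_at _ gd).
have int1 : complex.Re (integral_meas (fin_prod mu mu)
    (fun z : borel G * borel G => c (z.1 - z.2 : G))) = 1.
  exact: (cvg_unique _ lim lim1).
have [||E [mE ES E0 cE]] := integral_eq1_ae _ mSS SS0 bF _ int1.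
- exact: prob_fin_prodT.
- by move=> z _; apply: c_at_le1; exact: good_c_at.
by exists E; split => // z Ez; rewrite -(cE z Ez); exact: good_c_at.
Qed.

Lemma atoms_of_prob (mu : probability (borel G) R) a :
  atoms (cm_of_prob mu) a <-> mu [set a] != 0%E.
Proof.
rewrite /atoms /= /cm_val /= eq_complex /= eqxx andbT.
by rewrite -(@fineK _ (mu [set a])) ?fin_num_measure//; exact: borel_set1.
Qed.

(** Two atoms [g0] and [g1] form a point of positive mass of the product,
    hence not an exceptional one. For the support, fix [a] with [c(a - y) = 1]
    for almost all [y]: an open set that misses the closed coset of [a] has
    measure 0. *)
Lemma mean_square_cvg1 : good psi nu ->
  forall mu : probability (borel G) R, inner_regular mu ->
  (fun N => L2norm (nu N) (fourier psi (cm_of_prob mu)) ^+ 2) @ \oo --> (1 : R) ->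
  (exists a : G,
     measure_support mu `<=` [set a + x | x in closure (Gamma psi nu)]) /\
  (forall g0 g1 : G, atoms (cm_of_prob mu) g0 -> atoms (cm_of_prob mu) g1 ->
     c_at psi nu (g0 - g1) 1).
Proof.
move=> gd mu rmu lim1; have [E [mE E0 cE]] := mean_square_cvg1_ae gd rmu lim1.
have mEC := measurableC mE.
have mu1 : mu setT != 0%E by rewrite probability_setT.
split; last first.
  move=> g0 g1 /atoms_of_prob a0 /atoms_of_prob a1.
  apply: (cE (g0, g1)); apply: contrapT => Eg; move/eqP : a0; apply.
  have : fin_prod mu mu ([set g0] `*` [set g1]) = 0%E.
    apply: subset_measure0 E0 => //.
      by apply: measurableX; exact: borel_set1.
    by move=> [x y] /= [-> ->].
  rewrite [X in X = _ -> _]product_measure1E; try exact: borel_set1.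
  by move=> /eqP; rewrite mule_eq0 (negbTE a1) orbF => /eqP.
have [a Ea0] := null_section mEC mu1 E0.
exists a => x sx; have [xG|xG] := pselect (closure (Gamma psi nu) (x - a)).
  by exists (x - a) => //; rewrite addrC subrK.
(* [U] is the complement of the coset of [a], a neighbourhood of [x]. *)
exfalso; pose U : set G := (fun y => y - a) @^-1` (~` closure (Gamma psi nu)).
have oU : open U.
  apply: open_comp; last exact/closed_openC/closed_closure.
  move=> y _; apply: (@continuous_comp G (G * G)%type G (fun y => (y, a))
    (fun z => z.1 - z.2)); last exact: sub_continuous.
  by apply: cvg_pair; [exact: cvg_id|exact: cvg_cst].
have := sx U oU xG; rewrite ltNge => /negP; apply.
rewrite -Ea0; apply: le_measure; rewrite ?inE.
- exact: borel_open.
- exact: measurable_xsection.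
move=> y Uy; rewrite /xsection/= inE /= => Ey; apply: Uy; apply: subset_closure.
exists (1 : R[i])^*%C; last by rewrite conjc1 normr1.
by rewrite -(opprB a y); apply: c_atN; exact: (cE (a, y)).
Qed.

(** The set [B] of atoms is countable, hence sigma-compact, and of full
    measure. On [B * B] the means converge to 1. *)
Lemma discrete_mean_square (mu : probability (borel G) R) : discrete_measure mu ->
  (forall g0 g1 : G, atoms (cm_of_prob mu) g0 -> atoms (cm_of_prob mu) g1 ->
     c_at psi nu (g0 - g1) 1) ->
  (fun N => L2norm (nu N) (fourier psi (cm_of_prob mu)) ^+ 2) @ \oo --> (1 : R).
Proof.
move=> [A cA A0] c1; pose B : set (borel G) := A `&` [set a | mu [set a] != 0%E].
have cB : countable B by apply: sub_countable cA; apply: subset_card_le; exact: subIsetl.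
have mA : measurable (A : set (borel G)) by exact: borel_countable.
have mB : measurable B by exact: borel_countable.
have B0 : mu (~` B) = 0%E.
  have AB : ~` B `<=` ~` A `|` (A `\` B).
    by move=> x nBx; have [Ax|Ax] := pselect (A x); [right|left].
  have mAB : measurable (A `\` B : set (borel G)) by exact: measurableD.
  have AB0 : mu (A `\` B) = 0%E.
    apply: (@countable_null _ (borel G) R (@borel_set1 G) mu).
      by apply: sub_countable cA; apply: subset_card_le; exact: subIsetl.
    move=> a [Aa nBa]; apply/eqP; apply: contra_notT nBa => a0; by split.
  apply: subset_measure0 AB _ => //; first exact: measurableC.
    by apply: measurableU => //; exact: measurableC.
  by apply: null_set_setU => //; exact: measurableC.
have sB := sigma_compact_countable cB.
have mBB : measurable (B `*` B) by exact: measurableX.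
have BB0 := fin_prod_full mB mB B0 B0.
have [|_] := @cvg_mean_square_prob mu B _ (fun=> 1) sB B0 mBB (@subset_refl _ _) BB0.
  by move=> z [[_ a1] [_ a2]]; apply: c1; exact/atoms_of_prob.
by rewrite integral_meas_cst [X in fine X]prob_fin_prodT mul1r.
Qed.

Lemma ergodic_c_at g : ergodic psi nu -> c_at psi nu g (if g == 0 then 1 else 0).
Proof.
move=> [gd sp]; case: eqP => [->|g0]; first exact: c_at0.
have cg := @good_c_at g gd.
have [c0|c0] := eqVneq (c g) 0; first by rewrite -c0.
have : spectrum psi nu g by exists (c g).
by rewrite sp => gz; case: (g0 gz).
Qed.

(** As [c(a - y) = 1] forces [y = a], the complement of [a] lies in a null
    section of the exceptional set of [mean_square_cvg1_ae]. *)
Lemma ergodic_dirac : ergodic psi nu ->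
  forall mu : probability (borel G) R, inner_regular mu ->
  ((fun N => L2norm (nu N) (fourier psi (cm_of_prob mu)) ^+ 2) @ \oo --> (1 : R)) <->
  (exists g : G, forall A : set (borel G), measurable A ->
     mu A = dirac (g : borel G) A).
Proof.
move=> erg mu rmu; split=> [lim1|[g mug]]; last first.
  apply: discrete_mean_square.
    exists [set g]; first exact: countable1.
    rewrite mug; last by apply: measurableC; exact: borel_set1.
    by rewrite diracE memNset//=; apply.
  have atom_g a : atoms (cm_of_prob mu) a -> a = g.
    move=> /atoms_of_prob; rewrite mug; last exact: borel_set1.
    rewrite diracE; case: (boolP (_ \in _)); last by rewrite eqxx.
    by rewrite inE /= => ->.
  by move=> a b /atom_g -> /atom_g ->; rewrite subrr; exact: c_at0.
have [E [mE E0 cE]] := mean_square_cvg1_ae erg.1 rmu lim1.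
have mu1 : mu setT != 0%E by rewrite probability_setT.
have mEC := measurableC mE.
have [a Ea0] := null_section mEC mu1 E0.
have ma : measurable ([set a] : set (borel G)) by exact: borel_set1.
have a0 : mu (~` [set a]) = 0%E.
  apply: subset_measure0 Ea0; [exact: measurableC|exact: measurable_xsection|].
  move=> y ya; rewrite /xsection/= inE /= => Ey; apply: ya => /=.
  have := c_at_unique (cE _ Ey) (@ergodic_c_at (a - y : G) erg).
  case: eqP => [/subr0_eq//|_ /eqP]; by rewrite oner_eq0.
exists a => A mA; rewrite diracE; case: (boolP (_ \in _)).
  rewrite inE => Aa; apply/eqP; rewrite eq_le probability_le1//=.
  have -> : (1 = mu [set a])%E.
    by have := probability_setC mu ma; rewrite a0 => /eqP; rewrite eq_sym sube_eq ?fin_num_measure// add0e => /eqP.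
  by apply: le_measure; rewrite ?inE// => _ ->.
move=> /negP; rewrite inE => Aa; apply: subset_measure0 a0 => //.
  exact: measurableC.
by move=> y Ay ya; apply: Aa; rewrite -ya.
Qed.

End limits.

(** * Mean squares of an ergodic sequence *)

Section ergodic_limit.
Context (R : realType) (G H : lcaGroupType) (psi : dual_pair R G H).
Variables (nu : nat -> probability (borel H) R).
Hypothesis nu_reg : forall N, inner_regular (nu N).

Local Notation P := true.
Local Notation N := false.

(** With [p1, p2, p3, p4] the masses of the four parts at a point, [|mu{a}|^2 =
    (p1 - p2)^2 + (p3 - p4)^2]; the terms with a negative sign are moved to the
    left, as unordered sums are additive on nonnegative terms. *)
Lemma esum_square_parts (mu : complex_measure (borel G) R) (C : set G) :
  let e k l :=
    (\esum_(a in C) (cm_part mu k [set a] * cm_part mu l [set a]))%E in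
  (\esum_(a in C) (modulus (mu [set a]) ^+ 2)%:E +
    ((e (P, P) (P, N) + e (P, P) (P, N)) + (e (N, P) (N, N) + e (N, P) (N, N))) =
   (e (P, P) (P, P) + e (P, N) (P, N)) + (e (N, P) (N, P) + e (N, N) (N, N)))%E.
Proof.
have e0 k l a : (0 <= cm_part mu k [set a] * cm_part mu l [set a])%E.
  by rewrite mule_ge0.
move=> e; rewrite /e -!esumD; try by move=> a _; rewrite ?adde_ge0 ?e0 ?lee_fin ?sqr_ge0.
apply: eq_esum => a _; have ma := @borel_set1 G a.
have part_fin k : exists r, cm_part mu k [set a] = r%:E.
  by exists (fine (cm_part mu k [set a])); rewrite fineK// fin_num_measure.
have [rpp pp] := part_fin (P, P); have [rpn pn] := part_fin (P, N).
have [rnp np] := part_fin (N, P); have [rnn nn] := part_fin (N, N).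
rewrite (cm_valE mu ma) sum_parts pp pn np nn /cm_coef /=.
rewrite -!EFinM -!EFinD; congr (_%:E).
rewrite modulus_sqr !(ReD, ImD, ReM, ImM, ReN, ImN) /=; ring.
Qed.

(** The limit of the means is the indicator function of the diagonal, so the
    limit of the square norms is a combination of sums of [p{a} q{a}] over the
    parts [p], [q] of [mu]. In it the imaginary terms cancel by symmetry, and
    the real ones add up to the sum of [|mu{a}|^2]. *)
Lemma ergodic_mean_square : ergodic psi nu ->
  forall mu : complex_measure (borel G) R, cm_inner_regular mu ->
  (fun n => (L2norm (nu n) (fourier psi mu) ^+ 2)%:E) @ \oo -->
    (\esum_(a in atoms mu) (modulus (mu [set a]) ^+ 2)%:E)%E.
Proof.
move=> erg mu rmu; have [S sS mu0] := cm_sigma_compact rmu.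
have mS := sigma_compact_measurable sS.
have mSS : measurable (S `*` S) by exact: measurableX.
pose F (z : borel G * borel G) : R[i] := if (z.1 - z.2 : G) == 0 then 1 else 0.
have [bF lim] := cvg_mean_square_cm nu_reg sS mu0
  (fun z => @ergodic_c_at _ _ _ psi nu (z.1 - z.2) erg : c_at psi nu _ (F z)).
pose D : set (borel G * borel G) := [set z | S z.1 /\ z.1 = z.2].
have patchF z : cpatch (S `*` S) F z = (\1_D z)%:C.
  rewrite indicE; have [Sz|Sz] := pselect ((S `*` S) z); last first.
    rewrite cpatch_out// memNset// => -[Sz1 z12]; apply: Sz.
    by split => //=; rewrite -z12.
  rewrite cpatch_in// /F subr_eq0; case: eqP => z12.
    by rewrite mem_set//; split => //; case: Sz.
  by rewrite memNset// => -[].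
(* The diagonal over [S] is measurable as a level set of the limit [F] of
   measurable functions. *)
have mD : measurable D.
  have [[mF _] _] := bF; have := mF measurableT [set 1] (measurable_set1 1).
  rewrite setTI; congr measurable; apply/seteqP; split => z /=.
    rewrite patchF /= indicE; case: (boolP (z \in D)); first by rewrite inE.
    by move=> _ /eqP; rewrite eq_sym oner_eq0.
  by move=> Dz; rewrite patchF /= indicE mem_set.
pose C : set G := \bigcup_k [set a | cm_part mu k [set a] != 0%E].
have mset1 := @borel_set1 G.
have cC : countable C.
  by apply: bigcup_countable => // k _; exact: (@countable_atoms _ (borel G) R mset1).
pose e k l := (\esum_(a in C) (cm_part mu k [set a] * cm_part mu l [set a]))%E.
have fin_prodD k l : fin_prod (cm_part mu k) (cm_part mu l) D = e k l.
  apply: (@fin_prod_diagonal _ (borel G) R mset1 _ _ S C) => //.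
  by move=> a /= al; exists l.
have e_fin k l : e k l \is a fin_num.
  by rewrite -fin_prodD (@fin_num_measure _ _ _ (fin_prod _ _)).
have integralF k l : integral_meas (fin_prod (cm_part mu k) (cm_part mu l)) F =
    (fine (e k l))%:C.
  have SS0 := fin_prod_full mS mS (mu0 k) (mu0 l).
  rewrite (integral_meas_full _ mSS SS0) -fin_prodD; apply: eq_ReIm => /=.
    rewrite /Rintegral; congr fine.
    rewrite (eq_integral (fun z => (\1_D z)%:E)); last by move=> z _; rewrite patchF.
    by rewrite integral_indic// setIT.
  rewrite /Rintegral (eq_integral (cst 0%E)) ?integral0//.
  by move=> z _; rewrite patchF.
have eC k l : e k l = e l k by apply: eq_esum => a _; rewrite muleC.
pose E := (\esum_(a in C) (modulus (mu [set a]) ^+ 2)%:E)%E.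
have atomsE : (\esum_(a in atoms mu) (modulus (mu [set a]) ^+ 2)%:E)%E = E.
  have atomsC : atoms mu `<=` C.
    move=> a; apply: contraPP => nCa; apply/negP; rewrite negbK (cm_valE mu (mset1 a)).
    apply/eqP; rewrite big1// => k _; rewrite (_ : cm_part mu k [set a] = 0%E) ?mulr0//.
    by apply/eqP; apply: contra_notT nCa => ak; exists k.
  rewrite -(setIidr atomsC) esum_mkcondr; apply: eq_esum => a _.
  case: (boolP (a \in atoms mu)) => //; rewrite notin_setE /atoms/= => /negP.
  by rewrite negbK => /eqP ->; rewrite /modulus normr0 expr0n.
have := esum_square_parts mu C; rewrite -/e -/E => id.
have E_fin : E \is a fin_num.
  rewrite ge0_fin_numE; last by apply: esum_ge0 => a _; rewrite lee_fin sqr_ge0.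
  apply: (@le_lt_trans _ _ ((e (P, P) (P, P) + e (P, N) (P, N)) +
      (e (N, P) (N, P) + e (N, N) (N, N)))%E).
    have e0 k l : (0 <= e k l)%E by apply: esum_ge0 => a _; rewrite mule_ge0.
    by rewrite -id leeDl// !adde_ge0.
  by rewrite ltey_eq !fin_numD !e_fin.
rewrite atomsE -(fineK E_fin).
apply: (@cvg_EFin _ _ _ _ (fun n => (L2norm (nu n) (fourier psi mu) ^+ 2)%:E)).
  by apply: nearW.
have := cvg_real_complex lim; congr (_ --> _).
under eq_bigr => k _ do under eq_bigr => l _ do rewrite integralF.
rewrite (sesquilinear_expansion (fun k l => (fine (e k l))%:C)).
rewrite !(ReD, ImD, ReM, ImM, ReN, ImN) /=.
have /(congr1 fine) := id.
rewrite !fineD ?fin_numD ?e_fin ?E_fin//.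
rewrite (eC (P, N) (P, P)) (eC (N, N) (N, P)); lra.
Qed.

End ergodic_limit.

(** * Two-point measures detect ergodicity *)

Section point_masses.
Context (R : realType) (G : lcaGroupType).

Local Notation delta a :=
  (dirac (a : borel G) : {finite_measure set (borel G) -> \bar R}).

Definition cm_of_pair (p q : {finite_measure set (borel G) -> \bar R}) :
    complex_measure (borel G) R :=
  ComplexMeasure (charge_of_finite_measure p) (charge_of_finite_measure q).

(** The product of two Dirac measures is a Dirac measure. *)
Lemma integral_fin_prod_dirac (a b : borel G) (F : borel G * borel G -> R[i]) :
  integral_meas (fin_prod (delta a) (delta b)) F = F (a, b).
Proof.
rewrite -(@integral_dirac_point _ _ R (a, b)); last first.
  rewrite (_ : [set (a, b)] = [set a] `*` [set b]); last first.
    by apply/seteqP; split => [[x y] [-> ->]//|[x y] [/= -> ->]].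
  by apply: measurableX; exact: borel_set1.
apply: integral_meas_measure => A mA.
rewrite [LHS](integral_dirac a measurableT); last exact: measurable_fun_xsection.
by rewrite diracT mul1e /= !diracE mem_xsection.
Qed.

Lemma integral_meas_mzero (f : borel G -> R[i]) :
  integral_meas (mzero : {finite_measure set (borel G) -> \bar R}) f = 0.
Proof. by apply: eq_ReIm; rewrite /= /Rintegral integral_measure_zero. Qed.

Variables (p q : {finite_measure set (borel G) -> \bar R}) (S : set G).
Hypotheses (fS : finite_set S) (p0 : p (~` S) = 0%E) (q0 : q (~` S) = 0%E).

Let mS : measurable (S : set (borel G)).
Proof. by apply: borel_countable; exact: finite_set_countable. Qed.

Lemma sigma_compact_finite : sigma_compact_borel (S : set (borel G)).
Proof. by apply: sigma_compact_countable; exact: finite_set_countable. Qed.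

Lemma compact_finite (T : topologicalType) (A : set T) : finite_set A -> compact A.
Proof.
move=> /finite_fsetP[X ->].
rewrite -(image_id [set` X]) -bigcup_imset1 bigcup_fset.
elim/big_ind : _ => //; [exact: compact0|exact: compactU|].
by move=> i _; exact: compact_set1.
Qed.

Let inner_regular_charge (m : {finite_measure set (borel G) -> \bar R}) :
  m (~` S) = 0%E ->
  inner_regular (charge_variation (hahn_posneg (charge_of_finite_measure m))).
Proof.
move=> m0 A mA e e0; exists (A `&` S); split.
- by apply: compact_finite; exact: finite_setIr.
- exact: subIsetl.
have [np nn] : charge_null (charge_of_finite_measure m) (~` S).
  have b0 : bounded_cmfun (cpatch (S : set (borel G)) (fun=> 0 : R[i])).
    by apply: bounded_cmfun_patch => //; exact: bounded_cmfun_cst.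
  by have [] := integral_charge_measure mS m0 b0.
have mSC := measurableC mS.
have mAS : measurable (A `\` (A `&` S) : set (borel G)).
  by apply: measurableD => //; exact: measurableI.
have sub : A `\` (A `&` S) `<=` ~` S by move=> x [Ax nASx] Sx; exact: nASx.
rewrite /charge_variation.
have -> : jordan_pos (hahn_posneg (charge_of_finite_measure m)) (A `\` (A `&` S)) = 0%E.
  exact: subset_measure0 np.
have -> : jordan_neg (hahn_posneg (charge_of_finite_measure m)) (A `\` (A `&` S)) = 0%E.
  exact: subset_measure0 nn.
by rewrite adde0 lte_fin.
Qed.

Lemma cm_of_pair_inner_regular : cm_inner_regular (cm_of_pair p q).
Proof. by split; exact: inner_regular_charge. Qed.

Lemma integral_cm_of_pair (f : borel G -> R[i]) :
  bounded_cmfun (cpatch (S : set (borel G)) f) ->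
  integral_cm (cm_of_pair p q) f = integral_meas p f + 'i%C * integral_meas q f.
Proof.
move=> bf; rewrite /integral_cm -complexiE.
have [_ <-] := integral_charge_measure mS p0 bf.
by have [_ <-] := integral_charge_measure mS q0 bf.
Qed.

End point_masses.

Section ergodic_converse.
Context (R : realType) (G H : lcaGroupType) (psi : dual_pair R G H).
Variables (nu : nat -> probability (borel H) R).
Hypothesis nu_reg : forall N, inner_regular (nu N).
Hypothesis mean_square : forall mu : complex_measure (borel G) R, cm_inner_regular mu ->
  (fun n => (L2norm (nu n) (fourier psi mu) ^+ 2)%:E) @ \oo -->
    (\esum_(a in atoms mu) (modulus (mu [set a]) ^+ 2)%:E)%E.

Local Notation delta a :=
  (dirac (a : borel G) : {finite_measure set (borel G) -> \bar R}).

(** Here [p + i q] is [delta_0 + w delta_g] with [|w| = 1]. The square norm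
    of its transform is [2 + 2 Re(w m_N(g))], and the sum over its two
    atoms is 2. *)
Let two_points (g : G) (w : R[i]) (p q : {finite_measure set (borel G) -> \bar R}) :
  g != 0 -> modulus w = 1 -> p (~` [set 0; g]) = 0%E -> q (~` [set 0; g]) = 0%E ->
  (forall f, bounded_cmfun (cpatch ([set 0; g] : set (borel G)) f) ->
    integral_meas p f + 'i%C * integral_meas q f = f 0 + w * f g) ->
  (forall a : G, cm_of_pair p q [set a] = (a == 0)%:R + w * (a == g)%:R) ->
  (fun n => complex.Re (w * mean_seq psi nu g n)) @ \oo --> (0 : R).
Proof.
move=> g0 w1 p0 q0 pq_int pq_atoms; set mu := cm_of_pair p q.
have w0 : w != 0 by apply: contra_eq_neq w1 => ->; rewrite /modulus normr0 eq_sym oner_eq0.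
have fS : finite_set [set 0; g] by exact: finite_set2.
have := mean_square (cm_of_pair_inner_regular fS p0 q0); rewrite -/mu.
have -> : atoms mu = [set 0; g].
  apply/seteqP; split => a; rewrite /atoms/= pq_atoms.
    have [->|a0] := eqVneq a 0; first by left.
    have [->|ag] := eqVneq a g; first by right.
    by rewrite mulr0 addr0 eqxx.
  case=> ->; first by rewrite eqxx [0 == g]eq_sym (negbTE g0) mulr0 addr0 oner_eq0.
  by rewrite eqxx (negbTE g0) mulr1 add0r.
rewrite (esumID [set 0]); last by move=> a _; rewrite lee_fin sqr_ge0.
have -> : [set 0; g] `&` [set 0] = [set 0] :> set G.
  by apply/seteqP; split => x /=; [case|move=> ->; split=> //; left].
have -> : [set 0; g] `&` ~` [set 0] = [set g] :> set G.
  apply/seteqP; split => x /=; first by case=> -[].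
  by move=> ->; split; [right|exact/eqP].
rewrite !esum_set1 ?lee_fin ?sqr_ge0// !pq_atoms !eqxx [0 == g]eq_sym (negbTE g0).
rewrite mulr0 mulr1 addr0 add0r w1 /modulus normr1 !expr1n -EFinD.
move=> /fine_cvgP[_]; set u := (X in X @ _ --> _) => lim.
have uE n : u n = 2 + 2 * complex.Re (w * mean_seq psi nu g n).
  pose z (b : bool) : R[i] := if b then 1 else w.
  pose x (b : bool) : G := if b then 0 else g.
  have sS := sigma_compact_finite fS.
  have x0 b : delta (x b) (~` [set 0; g]) = 0%E.
    by rewrite [LHS]diracE memNset//= => -[]; case: b; [left|right].
  have := mean_square_sum psi nu_reg n z sS x0.
  rewrite !big_bool [z true]/z [z false]/z conjc1 !mul1r !mulr1 mulcJ w1 expr1n.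
  rewrite !integral_fin_prod_dirac /x /=.
  rewrite !subrr !mean0 sub0r subr0 meanN// => sumE.
  have -> : u n = complex.Re (u n)%:C by [].
  have -> : (u n)%:C = 1 + w^*%C * (mean_seq psi nu g n)^*%C +
     (w * mean_seq psi nu g n + 1).
    move: sumE; rewrite !mul1r => <-; congr (_%:C); congr (_ ^+ 2).
    congr L2norm; apply/funext => h; rewrite /fourier (integral_cm_of_pair fS p0 q0).
      rewrite pq_int; last first.
        exact: bounded_pairing2.
      rewrite big_bool /= !integral_dirac_point ?mul1r//; exact: borel_set1.
    exact: bounded_pairing2.
  rewrite -rmorphM /= !(ReD, ReJ) /=; ring.
have -> : (0 : R) = (1 + 1 - 2) / 2 by lra.
have -> : (fun n => complex.Re (w * mean_seq psi nu g n)) = (fun n => (u n - 2) / 2).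
  by apply/funext => n; rewrite uE; field.
by apply: cvgMl; apply: cvgB => //; exact: cvg_cst.
Qed.

(** The measure [delta_0 + w delta_g] tests [Re(w m_N(g))]; the values [w = 1]
    and [w = i] suffice. *)
Lemma mean_square_ergodic : ergodic psi nu.
Proof.
have c0 (g : G) : g != 0 -> c_at psi nu g 0.
  move=> g0.
  have dirac0 (a : G) : [set 0; g] a -> delta a (~` [set 0; g]) = 0%E.
    by move=> ga; rewrite [LHS]diracE memNset//= => -[].
  have d0 : delta 0 (~` [set 0; g]) = 0%E by apply: dirac0; left.
  have dg : delta g (~` [set 0; g]) = 0%E by apply: dirac0; right.
  have mset1 (a : G) := @borel_set1 G a.
  have dirac1 (x a : G) : delta x [set a] = (a == x)%:R%:E.
    rewrite [LHS]diracE; congr (_%:R%:E); congr nat_of_bool.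
    by apply/idP/eqP => [|->]; rewrite inE.
  have re : (fun n => complex.Re (1 * mean_seq psi nu g n)) @ \oo --> (0 : R).
    apply: (@two_points g 1 (fin_add (delta 0) (delta g)) mzero) => //.
    - by rewrite /modulus normr1.
    - by rewrite [LHS]fin_addE d0 dg adde0.
    - move=> f bf; rewrite integral_meas_mzero mulr0 addr0.
      have S0 : fin_add (delta 0) (delta g) (~` [set 0; g]) = 0%E.
        by rewrite [LHS]fin_addE d0 dg adde0.
      have mS : measurable ([set 0; g] : set (borel G)).
        by apply: borel_countable; apply: finite_set_countable; exact: finite_set2.
      rewrite (integral_meas_full _ mS S0) integral_fin_add//.
      rewrite -!(integral_meas_full _ mS)// !integral_dirac_point// mul1r//.
    - move=> a; transitivity
        (fine (delta (0 : G)%R [set a] + delta g [set a])%E +i* 0 : R[i]).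
        by apply: eq_ReIm => //=; rewrite [X in fine X]fin_addE.
      rewrite !dirac1 mul1r; apply: eq_ReIm; rewrite ?ReD ?ImD.
        by case: (a == 0); case: (a == g); rewrite /= ?addr0 ?add0r.
      by case: (a == 0); case: (a == g); rewrite /= ?addr0.
  have im : (fun n => complex.Re ('i%C * mean_seq psi nu g n)) @ \oo --> (0 : R).
    apply: (@two_points g 'i%C (delta 0) (delta g)) => //.
    - by rewrite /modulus normc_def /= expr0n expr1n add0r sqrtr1.
    - by move=> f bf; rewrite !integral_dirac_point.
    - move=> a; transitivity
        (fine (delta 0 [set a]) +i* fine (delta g [set a]) : R[i]) => //.
      rewrite !dirac1; apply: eq_ReIm; rewrite ?ReD ?ImD ?ReM ?ImM.
        by case: (a == 0); case: (a == g); rewrite /= ?(mulr0, mul0r, subr0, addr0).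
      by case: (a == 0); case: (a == g); rewrite /= ?(mulr0, mul0r, mul1r, add0r, addr0).
  apply/cvg_complexP; split => /=.
    by move: re; under eq_fun do rewrite mul1r.
  rewrite (_ : (fun n => _) = fun n => - complex.Re ('i%C * mean_seq psi nu g n)).
    by have imN := cvgN im; rewrite oppr0 in imN; exact: imN.
  by apply/funext => n; rewrite ReM /=; ring.
split.
  move=> g; have [->|g0] := eqVneq g 0; first exact: cvgP (c_at0 psi nu).
  exact: cvgP (c0 g g0).
apply/seteqP; split => [g [z cz z0]|_ ->]; last first.
  by exists 1; [exact: c_at0|exact: oner_neq0].
apply/eqP; apply: contra_neqT z0 => g0.
exact: c_at_unique cz (c0 _ g0).
Qed.

End ergodic_converse.

Theorem theorem3p9 (R : realType) (G H : lcaGroupType) (psi : dual_pair R G H)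
    (nu : nat -> probability (borel H) R)
    (nu_reg : forall N, inner_regular (nu N)) :
  (* (1) *)
  (good psi nu ->
    forall mu : complex_measure (borel G) R, cm_inner_regular mu ->
    (fun N => (L2norm (nu N) (fourier psi mu) ^+ 2)%:C : R[i]^o) @ \oo -->
      (integral_cm (prod_cm mu (cm_conj mu))
         (fun p => c_fun psi nu (p.1 - p.2)) : R[i]^o)) /\
  (* (2) *)
  (good psi nu ->
    forall mu : probability (borel G) R, inner_regular mu ->
    (fun N => L2norm (nu N) (fourier psi (cm_of_prob mu)) ^+ 2) @ \oo -->
      (1 : R) ->
    (exists a : G,
       measure_support mu `<=` [set a + x | x in closure (Gamma psi nu)]) /\
    (forall g0 g1 : G, atoms (cm_of_prob mu) g0 -> atoms (cm_of_prob mu) g1 ->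
       c_at psi nu (g0 - g1) 1)) /\
  (* (3) *)
  (forall mu : probability (borel G) R, discrete_measure mu ->
    (forall g0 g1 : G, atoms (cm_of_prob mu) g0 -> atoms (cm_of_prob mu) g1 ->
       c_at psi nu (g0 - g1) 1) ->
    (fun N => L2norm (nu N) (fourier psi (cm_of_prob mu)) ^+ 2) @ \oo -->
      (1 : R)) /\
  (* (4) *)
  (ergodic psi nu <->
    forall mu : complex_measure (borel G) R, cm_inner_regular mu ->
    (fun N => (L2norm (nu N) (fourier psi mu) ^+ 2)%:E) @ \oo -->
      (\esum_(a in atoms mu) (modulus (mu [set a]) ^+ 2)%:E)%E) /\
  (* (5) *)
  (ergodic psi nu ->
    forall mu : probability (borel G) R, inner_regular mu ->
    ((fun N => L2norm (nu N) (fourier psi (cm_of_prob mu)) ^+ 2) @ \oo -->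
       (1 : R)) <->
    (exists g : G, forall A : set (borel G), measurable A ->
       mu A = dirac (g : borel G) A)).
Proof.
split; first exact: mean_square_cvg.
split; first exact: mean_square_cvg1.
split; first exact: discrete_mean_square.
split; last exact: ergodic_dirac.
split; first exact: ergodic_mean_square.
exact: mean_square_ergodic.
Qed.
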